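(* The invariant subalgebra $H^*(BT;\mathbb{Z}_3)^{W(E_6)}$ is generated, as a $\mathbb{Z}_3$-algebra, by the following thirteen elements: $$x_4,\ x_8,\ y_{10},\ x_{20},\ y_{22},\ y_{26},\ x_{36},\ x_{48},\ x_{54},\ y_{58},\ y_{60},\ y_{64},\ y_{76}.$$
   Context: $\mathbb{Z}_3$ denotes the field with 3 elements. $T$ is a maximal torus of the compact simply connected exceptional Lie group $E_6$, and $H^*(BT;\mathbb{Z}_3)=\mathbb{Z}_3[\beta_1,\dots,\beta_6]$ is the polynomial algebra on the mod 3 reductions of the fundamental weights $\beta_1,\dots,\beta_6$, each of degree 2. The simple roots $\alpha_1,\dots,\alpha_6$ are numbered as in Bourbaki: the edges of the Dynkin diagram are $\alpha_1\alpha_3,\ \alpha_3\alpha_4,\ \alpha_4\alpha_5,\ \alpha_5\alpha_6,\ \alpha_2\alpha_4$, with $\langle\alpha_i,\alpha_i\rangle=2$, $\langle\alpha_i,\alpha_j\rangle=-1$ if $\alpha_i,\alpha_j$ are connected ($i\ne j$), and $0$ otherwise. The Weyl group $W(E_6)$ is generated by the simple reflections $R_1,\dots,R_6$, and acts on $H^*(BT;\mathbb{Z}_3)$ by algebra automorphisms determined by $R_i(\beta_i)=\beta_i-\sum_j\langle\alpha_i,\alpha_j\rangle\beta_j$ and $R_i(\beta_j)=\beta_j$ for $j\neq i$. Put (with $\tfrac12$ the inverse of $2$ in $\mathbb{Z}_3$) $t=\beta_1$, $t_1=\tfrac12\beta_1+\beta_2-\beta_3$, $t_2=-\tfrac12\beta_1+\beta_2+\beta_3-\beta_4$,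 $t_3=-\tfrac12\beta_1+\beta_4-\beta_5$, $t_4=-\tfrac12\beta_1+\beta_5-\beta_6$, $t_5=-\tfrac12\beta_1+\beta_6$. Then $H^*(BT;\mathbb{Z}_3)=\mathbb{Z}_3[t,t_1,\dots,t_5]$. Let $p_i$ be the $i$-th elementary symmetric polynomial in $t_1^2,\dots,t_5^2$ and $c_5=t_1t_2t_3t_4t_5$. Define - $x_4=p_1$, $x_8=p_2-p_1^2$, $y_{10}=c_5-tx_8-t^3x_4$; - $h_{12}=p_3+ty_{10}-t^2x_8-t^4x_4$, $h_{16}=p_4+t^3y_{10}-t^4x_8-t^6x_4$; - $h_{18}=t(h_{16}-x_8^2)+t^3(-h_{12}+x_4x_8)+t^5x_8-t^7x_4+t^9$; - $x_{20}=h_{12}x_8+h_{16}x_4$, $y_{22}=h_{12}y_{10}-h_{18}x_4$, $y_{26}=h_{16}y_{10}+h_{18}x_8$; - $g_{24}=-t^8x_8+t^7y_{10}-t^6x_4^3+t^6x_4x_8+t^4x_4^2x_8-t^4x_8^2+t^3h_{18}+t^3x_4^2y_{10}-t^3x_8y_{10}+t^2x_{20}-t^2y_{10}^2-ty_{22}-tx_4x_8y_{10}$; - $x_{36}=-g_{24}x_4^3+h_{12}^3-h_{12}^2x_4x_8-h_{12}x_{20}x_4+h_{12}x_4^2x_8^2$; - $x_{48}=h_{16}^3+h_{16}^2x_8^2+h_{16}x_8^4+g_{24}x_8^3$; - $x_{54}=h_{18}^3-h_{16}h_{18}y_{10}^2+h_{18}^2x_8y_{10}+h_{18}x_8^2y_{10}^2-g_{24}y_{10}^3$;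 - $y_{58}=(x_{36}x_8^2y_{10}-x_{20}^2y_{22})/x_4$; - $y_{60}=(x_{36}x_8y_{10}^2-x_{20}y_{22}^2)/x_4$; - $y_{64}=(y_{58}y_{10}-x_{20}y_{22}y_{26}-y_{22}^2x_8^3)/x_4$; - $y_{76}=(y_{58}y_{22}+y_{60}x_{20}+x_{20}y_{22}^2x_8^2)/x_4$. The quotients are formed in the fraction field of $\mathbb{Z}_3[t,t_1,\dots,t_5]$, and they lie in $\mathbb{Z}_3[t,t_1,\dots,t_5]$. Subscripts denote degrees. *)

(* Defs.v *)
From HB Require Import structures.
From mathcomp Require Import all_boot all_order all_algebra.
From mathcomp Require Export mpoly.

Set Implicit Arguments.
Unset Strict Implicit.
Unset Printing Implicit Defensive.

Import GRing.Theory.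
Local Open Scope ring_scope.

(* H^*(BT; Z_3), ungraded: the variable 'X_i, i : 'I_6, is the mod 3 reduction
   of the fundamental weight beta_(i+1). *)
Notation HBT := {mpoly 'F_3[6]}.

(* Nodes carry the Bourbaki labels 1..6, hence the successors below. *)
Definition E6_edges : seq (nat * nat) :=
  [:: (1, 3); (3, 4); (4, 5); (5, 6); (2, 4)]%N.

Definition E6_pairing (i j : 'I_6) : int :=
  if i == j then 2
  else if ((i.+1, j.+1) \in E6_edges) || ((j.+1, i.+1) \in E6_edges) then -1
  else 0.

(* Lattice automorphisms are written in the basis of fundamental weights: row j
   of the matrix is the image of beta_(j+1). *)
Definition E6_reflection (i : 'I_6) : 'M[int]_6 :=
  \matrix_(j, k) ((j == k)%:R - (j == i)%:R * E6_pairing i k).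

Inductive weyl_E6 : 'M[int]_6 -> Prop :=
| weyl_E6_refl i : weyl_E6 (E6_reflection i)
| weyl_E6_one : weyl_E6 1%:M
| weyl_E6_mul v w : weyl_E6 v -> weyl_E6 w -> weyl_E6 (v *m w)
| weyl_E6_inv w : weyl_E6 w -> weyl_E6 (invmx w).

Definition lattice_act (w : 'M[int]_6) (f : HBT) : HBT :=
  f \mPo [tuple \sum_(k < 6) ((w j k)%:~R : 'F_3) *: 'X_k | j < 6].

Definition weyl_E6_invariant (f : HBT) : Prop :=
  forall w, weyl_E6 w -> lattice_act w f = f.

(* beta k is meaningful for 1 <= k <= 6 only. *)
Definition beta (k : nat) : HBT := 'X_(inord k.-1).

Definition half_F3 : 'F_3 := 2%:R^-1.

Definition t : HBT := beta 1.
Definition t1 : HBT := half_F3 *: beta 1 + beta 2 - beta 3.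
Definition t2 : HBT := - (half_F3 *: beta 1) + beta 2 + beta 3 - beta 4.
Definition t3 : HBT := - (half_F3 *: beta 1) + beta 4 - beta 5.
Definition t4 : HBT := - (half_F3 *: beta 1) + beta 5 - beta 6.
Definition t5 : HBT := - (half_F3 *: beta 1) + beta 6.

Definition p (i : nat) : HBT :=
  mesym 5 'F_3 i \mPo [tuple t1 ^+ 2; t2 ^+ 2; t3 ^+ 2; t4 ^+ 2; t5 ^+ 2].
Definition c5 : HBT := t1 * t2 * t3 * t4 * t5.

Definition x4 : HBT := p 1.
Definition x8 : HBT := p 2 - p 1 ^+ 2.
Definition y10 : HBT := c5 - t * x8 - t ^+ 3 * x4.

Definition h12 : HBT := p 3 + t * y10 - t ^+ 2 * x8 - t ^+ 4 * x4.
Definition h16 : HBT := p 4 + t ^+ 3 * y10 - t ^+ 4 * x8 - t ^+ 6 * x4.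
Definition h18 : HBT :=
  t * (h16 - x8 ^+ 2) + t ^+ 3 * (- h12 + x4 * x8)
  + t ^+ 5 * x8 - t ^+ 7 * x4 + t ^+ 9.

Definition x20 : HBT := h12 * x8 + h16 * x4.
Definition y22 : HBT := h12 * y10 - h18 * x4.
Definition y26 : HBT := h16 * y10 + h18 * x8.

Definition g24 : HBT :=
  - (t ^+ 8 * x8) + t ^+ 7 * y10 - t ^+ 6 * x4 ^+ 3 + t ^+ 6 * x4 * x8
  + t ^+ 4 * x4 ^+ 2 * x8 - t ^+ 4 * x8 ^+ 2 + t ^+ 3 * h18
  + t ^+ 3 * x4 ^+ 2 * y10 - t ^+ 3 * x8 * y10 + t ^+ 2 * x20
  - t ^+ 2 * y10 ^+ 2 - t * y22 - t * x4 * x8 * y10.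

Definition x36 : HBT :=
  - (g24 * x4 ^+ 3) + h12 ^+ 3 - h12 ^+ 2 * x4 * x8 - h12 * x20 * x4
  + h12 * x4 ^+ 2 * x8 ^+ 2.
Definition x48 : HBT :=
  h16 ^+ 3 + h16 ^+ 2 * x8 ^+ 2 + h16 * x8 ^+ 4 + g24 * x8 ^+ 3.
Definition x54 : HBT :=
  h18 ^+ 3 - h16 * h18 * y10 ^+ 2 + h18 ^+ 2 * x8 * y10
  + h18 * x8 ^+ 2 * y10 ^+ 2 - g24 * y10 ^+ 3.

Notation "x %:F" := (@FracField.tofrac _ x) : ring_scope.

Definition y58 : {fraction HBT} :=
  (x36 * x8 ^+ 2 * y10 - x20 ^+ 2 * y22)%:F / x4%:F.
Definition y60 : {fraction HBT} :=
  (x36 * x8 * y10 ^+ 2 - x20 * y22 ^+ 2)%:F / x4%:F.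
Definition y64 : {fraction HBT} :=
  (y58 * y10%:F - (x20 * y22 * y26)%:F - (y22 ^+ 2 * x8 ^+ 3)%:F) / x4%:F.
Definition y76 : {fraction HBT} :=
  (y58 * y22%:F + y60 * x20%:F + (x20 * y22 ^+ 2 * x8 ^+ 2)%:F) / x4%:F.

Definition E6_generators : 13.-tuple {fraction HBT} :=
  [tuple x4%:F; x8%:F; y10%:F; x20%:F; y22%:F; y26%:F; x36%:F; x48%:F; x54%:F;
         y58; y60; y64; y76].

Definition generated_subalgebra (n : nat) (g : n.-tuple HBT) (f : HBT) : Prop :=
  exists q : {mpoly 'F_3[n]}, f = q \mPo g.

(* Main.v *)
From HB Require Import structures.
Require Import Defs.
From mathcomp Require Import all_boot all_order all_algebra.
From mathcomp Require Import zify ring.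

Set Implicit Arguments.
Unset Strict Implicit.
Unset Printing Implicit Defensive.

Import Order.TTheory GRing.Theory.
Local Open Scope ring_scope.

(** Let A be the algebra generated by the thirteen elements. The reflections
    R_2, ..., R_6 generate a Weyl group of type D_5 fixing t, whose invariants
    are the polynomial algebra S = F_3[t, p_1, ..., p_4, c_5]
    = F_3[t, x4, x8, y10, h12, h16]. The relations defining h18 and x36 show
    that, after inverting x4, S is spanned over A by the 27 monomials t^i h12^j
    with i < 9 and j < 3. Since t has 27 distinct conjugates, a Vandermonde
    argument turns this into: for every invariant f, some x4^k f lies in A.

    It remains to see that x4 f in A implies f in A for f in S. Thirty-six
    relations among the generators rewrite every element of A, modulo x4 A,
    into a combination of normal monomials. The images of the normal monomials
    in S/(x4) = F_3[t, x8, y10, h12, h16] have pairwise distinct leading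
    monomials, so a combination divisible by x4 in S is zero. *)

(** * Certified arithmetic of sparse polynomials over F_3 *)

(** Invariants are therefore recognised by coordinates in a 27-element spanning family, at the price
    of inverting x4. Two features keep the computations feasible. The relations among the
    generators, and the divisions by x4 that define the last four of them, already hold when x4, x8,
    y10, h12, h16, h18, g24 are seven independent variables; only the two relations spanning S over
    A and the invariance under R_1 use the actual dependence on t. Moreover every identity is stated
    on reified formulas and decided by comparing normal forms. Of the rewriting rules only
    correctness and termination are checked; the independence of the normal monomials comes from the
    leading monomials of the specialisation at x4 = 0. *)

Inductive expr :=
| Var of nat | Add of expr & expr | Opp of expr | Mul of expr & expr
| Pow of expr & nat.

Lemma expr_eq_dec : comparable expr.
Proof.
by move=> e1 e2; rewrite /decidable; decide equality; apply: eq_comparable.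
Qed.

HB.instance Definition _ := hasDecEq.Build expr (compareP expr_eq_dec).

Declare Scope expr_scope.
Delimit Scope expr_scope with X.
Bind Scope expr_scope with expr.
Notation "x + y" := (Add x y) : expr_scope.
Notation "- x" := (Opp x) : expr_scope.
Notation "x - y" := (Add x (Opp y)) : expr_scope.
Notation "x * y" := (Mul x y) : expr_scope.
Notation "x ^+ n" := (Pow x n) : expr_scope.

(** The same tree can be evaluated in any commutative ring and fed to [norm], so an identity decided
    by computation transfers to [mpoly]. The syntax has no constants; zero is written x - x. *)
Fixpoint eval (R : comNzRingType) (env : seq R) (e : expr) : R :=
  match e with
  | Var i => env`_i
  | Add e1 e2 => eval env e1 + eval env e2
  | Opp e1 => - eval env e1
  | Mul e1 e2 => eval env e1 * eval env e2
  | Pow e1 n => eval env e1 ^+ n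
  end.

Lemma rmorph_eval (R S : comNzRingType) (phi : {rmorphism R -> S}) env e :
  phi (eval env e) = eval [seq phi x | x <- env] e.
Proof.
elim: e => /= [i|e1 <- e2 <-|e1 <-|e1 <- e2 <-|e1 <- n].
- have [ltin|leni] := ltnP i (size env); first by rewrite (nth_map 0).
  by rewrite !nth_default ?size_map ?rmorph0.
- exact: rmorphD.
- exact: rmorphN.
- exact: rmorphM.
- exact: rmorphXn.
Qed.

(* A sparse polynomial over F_3 is a list of signed monomials, the sign [true]
   standing for the coefficient -1; trailing zero exponents are dropped. *)
Definition mono := seq nat.
Definition spoly := seq (bool * mono).

Fixpoint mono_mul (m1 m2 : mono) : mono :=
  match m1, m2 with
  | k1 :: m1', k2 :: m2' => (k1 + k2)%N :: mono_mul m1' m2'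
  | [::], m | m, [::] => m
  end.

Fixpoint lex_gt (m1 m2 : mono) : bool :=
  match m1, m2 with
  | k1 :: m1', k2 :: m2' => (k2 < k1)%N || (k1 == k2) && lex_gt m1' m2'
  | [::], _ => false
  | k1 :: m1', [::] => (0 < k1)%N || lex_gt m1' [::]
  end.

(** Graded lexicographic, to agree with the order of multinomials behind [mlead] (see
    [mono_gt_ltmc]). *)
Definition mono_gt (m1 m2 : mono) : bool :=
  (sumn m2 < sumn m1)%N || (sumn m1 == sumn m2) && lex_gt m1 m2.

(** A merge of decreasing lists. In characteristic 3 one has m + m = - m, so equal signs flip and
    opposite signs cancel. *)
Fixpoint sadd (p : spoly) : spoly -> spoly :=
  match p with
  | [::] => id
  | (s1, m1) :: p' =>
      fix sadd_p q := match q with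
      | [::] => p
      | (s2, m2) :: q' =>
          if m1 == m2 then
            if s1 == s2 then (~~ s1, m1) :: sadd p' q' else sadd p' q'
          else if mono_gt m1 m2 then (s1, m1) :: sadd p' q
          else (s2, m2) :: sadd_p q'
      end
  end.

Definition sscale (s : bool) (m : mono) (p : spoly) : spoly :=
  [seq (s (+) t.1, mono_mul m t.2) | t <- p].

Definition smul (p q : spoly) : spoly :=
  foldr (fun t => sadd (sscale t.1 t.2 q)) [::] p.

Definition sone : spoly := [:: (false, [::])].

Fixpoint norm (env : seq spoly) (e : expr) : spoly :=
  match e with
  | Var i => nth [::] env i
  | Add e1 e2 => sadd (norm env e1) (norm env e2)
  | Opp e1 => sscale true [::] (norm env e1)
  | Mul e1 e2 => smul (norm env e1) (norm env e2)
  | Pow e1 n => let p := norm env e1 in iter n (smul p) sone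
  end.

Definition svars (n : nat) : seq spoly :=
  mkseq (fun i => [:: (false, ncons i 0%N [:: 1%N])]) n.

Section SparseSoundness.
Variable R : comNzRingType.
Hypothesis char3 : 3%:R = 0 :> R.
Implicit Types (env : seq R) (m : mono) (p q : spoly).

Fixpoint mval env m : R :=
  match env, m with
  | x :: env', k :: m' => x ^+ k * mval env' m'
  | _, _ => 1
  end.

Definition speval env p : R := \sum_(t <- p) (-1) ^+ t.1 * mval env t.2.

Lemma mval_mul env m1 m2 : mval env (mono_mul m1 m2) = mval env m1 * mval env m2.
Proof.
elim: env m1 m2 => [|x env IH] [|k1 m1] [|k2 m2] //=; rewrite ?mulr1 ?mul1r //.
by rewrite IH exprD mulrACA.
Qed.

Lemma mval0 env : mval env [::] = 1. Proof. by case: env. Qed.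

Lemma speval_cons env t p :
  speval env (t :: p) = (-1) ^+ t.1 * mval env t.2 + speval env p.
Proof. exact: big_cons. Qed.

Lemma speval_add env p q : speval env (sadd p q) = speval env p + speval env q.
Proof.
have nil0 : speval env [::] = 0 by exact: big_nil.
elim: p q => [|[s1 m1] p IHp]; first by move=> q /=; rewrite nil0 add0r.
elim=> [|[s2 m2] q IHq]; first by rewrite nil0 addr0.
rewrite /sadd -/sadd -/(sadd ((s1, m1) :: p)).
have [<-|_] := eqVneq m1 m2; last first.
  case: ifP => _; rewrite speval_cons; first by rewrite IHp !speval_cons addrA.
  by rewrite IHq (speval_cons env _ q) [RHS]addrCA.
have [<-|] := eqVneq s1 s2; rewrite ?speval_cons IHp ?speval_cons /= addrACA.
  rewrite -mulrDl; congr (_ * _ + _).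
  have two : 1 + 1 = -1 :> R.
    by apply/eqP; rewrite -subr_eq0 opprK -addrA; apply/eqP.
  by case: s1 {IHq}; rewrite ?expr0 ?expr1 ?two // -opprD two opprK.
by case: s1 s2 {IHq} => [] [] // _; rewrite -mulrDl ?subrr ?addNr mul0r add0r.
Qed.

Lemma speval_scale env s m p :
  speval env (sscale s m p) = (-1) ^+ s * mval env m * speval env p.
Proof.
rewrite /speval big_map mulr_sumr; apply: eq_bigr => t _ /=.
by rewrite mval_mul signr_addb mulrACA.
Qed.

Lemma speval_mul env p q : speval env (smul p q) = speval env p * speval env q.
Proof.
elim: p => [|t p IH]; first by rewrite /speval !big_nil mul0r.
by rewrite /= speval_add speval_scale IH speval_cons mulrDl.
Qed.

Lemma speval_norm env senv e :
  speval env (norm senv e) = eval [seq speval env p | p <- senv] e.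
Proof.
elim: e => /= [i|e1 <- e2 <-|e1 <-|e1 <- e2 <-|e1 <- n].
- have [ltin|leni] := ltnP i (size senv); first by rewrite (nth_map [::]).
  by rewrite !nth_default ?size_map // /speval big_nil.
- exact: speval_add.
- by rewrite speval_scale mval0 mulr1 mulN1r.
- exact: speval_mul.
- elim: n => [|n IH]; first by rewrite /speval big_seq1 mval0 expr0 mulr1.
  by rewrite iterS speval_mul IH exprS.
Qed.

Lemma speval_vars env : [seq speval env p | p <- svars (size env)] = env.
Proof.
apply: (@eq_from_nth _ 0) => [|i]; rewrite size_map size_mkseq // => lti.
rewrite (nth_map [::]) ?size_mkseq // nth_mkseq // /speval big_seq1 expr0 mul1r.
elim: i env lti => [|i IH] [|x env] //= lti; last by rewrite mul1r IH.
by rewrite mval0 expr1 mulr1.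
Qed.

Lemma eval_norm env e : eval env e = speval env (norm (svars (size env)) e).
Proof. by rewrite speval_norm speval_vars. Qed.

End SparseSoundness.

(** * Formulas for the generators and their relations *)

Section InvariantFormulas.
Local Notation X4 := (Var 0).
Local Notation X8 := (Var 1).
Local Notation Y10 := (Var 2).
Local Notation H12 := (Var 3).
Local Notation H16 := (Var 4).
Local Notation H18 := (Var 5).
Local Notation G24 := (Var 6).

Definition x20_expr := (H12 * X8 + H16 * X4)%X.
Definition y22_expr := (H12 * Y10 - H18 * X4)%X.
Definition y26_expr := (H16 * Y10 + H18 * X8)%X.
Definition x36_expr :=
  (- (G24 * X4 ^+ 3) + H12 ^+ 3 - H12 ^+ 2 * X4 * X8 - H12 * x20_expr * X4
   + H12 * X4 ^+ 2 * X8 ^+ 2)%X.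
Definition x48_expr :=
  (H16 ^+ 3 + H16 ^+ 2 * X8 ^+ 2 + H16 * X8 ^+ 4 + G24 * X8 ^+ 3)%X.
Definition x54_expr :=
  (H18 ^+ 3 - H16 * H18 * Y10 ^+ 2 + H18 ^+ 2 * X8 * Y10
   + H18 * X8 ^+ 2 * Y10 ^+ 2 - G24 * Y10 ^+ 3)%X.
(** This and the next three formulas are the quotients by x4 carried out explicitly;
    [gens_numerator] certifies them. *)
Definition y58_expr :=
  (X8 * Y10 * H12 ^+ 2 * H16 + X8 ^+ 2 * H12 ^+ 2 * H18 + X8 ^+ 3 * Y10 *
   H12 ^+ 2 - X4 * Y10 * H12 * H16 ^+ 2 - X4 * X8 * H12 * H16 * H18 -
   X4 * X8 ^+ 2 * Y10 * H12 * H16 + X4 * X8 ^+ 4 * Y10 * H12 + X4 ^+ 2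
   * H16 ^+ 2 * H18 - X4 ^+ 2 * X8 ^+ 2 * Y10 * G24)%X.
Definition y60_expr :=
  (- (Y10 ^+ 2 * H12 ^+ 2 * H16) - X8 * Y10 * H12 ^+ 2 * H18 + X8 ^+ 2 *
   Y10 ^+ 2 * H12 ^+ 2 - X4 * Y10 * H12 * H16 * H18 - X4 * X8 * H12 *
   H18 ^+ 2 - X4 * X8 * Y10 ^+ 2 * H12 * H16 + X4 * X8 ^+ 3 * Y10 ^+ 2
   * H12 - X4 ^+ 2 * H16 * H18 ^+ 2 - X4 ^+ 2 * X8 * Y10 ^+ 2 * G24)%X.
Definition y64_expr :=
  (Y10 ^+ 2 * H12 * H16 ^+ 2 - X8 * Y10 * H12 * H16 * H18 + X8 ^+ 2 * H12
   * H18 ^+ 2 - X8 ^+ 2 * Y10 ^+ 2 * H12 * H16 - X8 ^+ 3 * Y10 * H12 *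
   H18 + X8 ^+ 4 * Y10 ^+ 2 * H12 - X4 * Y10 * H16 ^+ 2 * H18 + X4 *
   X8 * H16 * H18 ^+ 2 - X4 * X8 ^+ 2 * Y10 ^+ 2 * G24 - X4 * X8 ^+ 3
   * H18 ^+ 2)%X.
Definition y76_expr :=
  (Y10 ^+ 2 * H12 ^+ 2 * H16 ^+ 2 - X8 * Y10 * H12 ^+ 2 * H16 * H18 +
   X8 ^+ 2 * H12 ^+ 2 * H18 ^+ 2 - X8 ^+ 4 * Y10 ^+ 2 * H12 ^+ 2 + X4
   * Y10 * H12 * H16 ^+ 2 * H18 - X4 * X8 * H12 * H16 * H18 ^+ 2 - X4
   * X8 * Y10 ^+ 2 * H12 * H16 ^+ 2 - X4 * X8 ^+ 2 * Y10 * H12 * H16 *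
   H18 + X4 * X8 ^+ 2 * Y10 ^+ 2 * H12 * G24 + X4 * X8 ^+ 3 * H12 *
   H18 ^+ 2 + X4 * X8 ^+ 3 * Y10 ^+ 2 * H12 * H16 - X4 * X8 ^+ 4 * Y10
   * H12 * H18 + X4 ^+ 2 * H16 ^+ 2 * H18 ^+ 2 - X4 ^+ 2 * X8 *
   Y10 ^+ 2 * H16 * G24 + X4 ^+ 2 * X8 ^+ 2 * H16 * H18 ^+ 2 + X4 ^+ 2
   * X8 ^+ 2 * Y10 * H18 * G24)%X.

Definition gen_exprs : seq expr :=
  [:: X4; X8; Y10; x20_expr; y22_expr; y26_expr; x36_expr; x48_expr; x54_expr;
      y58_expr; y60_expr; y64_expr; y76_expr].
End InvariantFormulas.

Fixpoint mono_weight (w : seq nat) (m : mono) : nat :=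
  match w, m with
  | a :: w', k :: m' => (a * k + mono_weight w' m')%N
  | _, _ => 0%N
  end.

Section Rules.
Local Notation X4 := (Var 0).
Local Notation X8 := (Var 1).
Local Notation Y10 := (Var 2).
Local Notation X20 := (Var 3).
Local Notation Y22 := (Var 4).
Local Notation Y26 := (Var 5).
Local Notation X36 := (Var 6).
Local Notation X48 := (Var 7).
Local Notation X54 := (Var 8).
Local Notation Y58 := (Var 9).
Local Notation Y60 := (Var 10).
Local Notation Y64 := (Var 11).
Local Notation Y76 := (Var 12).
Local Open Scope expr_scope.

(* A triple (l, r, s) records the relation l = r + x4 * s between the
   generators. *)
Definition rules : seq (expr * expr * expr) :=
  [::
   (X8 * Y22,
    Y10 * X20,
    - Y26);
   (Y26 ^+ 3,
    Y10 ^+ 3 * X48 + X8 ^+ 3 * X54 - X8 ^+ 2 * Y10 * Y26 ^+ 2 - X8 ^+ 4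
      * Y10 ^+ 2 * Y26,
    X4 - X4);
   (Y26 * Y64,
    Y10 ^+ 2 * Y22 * X48 + X8 ^+ 2 * X20 * X54 + X8 * Y10 * X20 *
      Y26 ^+ 2,
    - (X8 * Y10 ^+ 3 * X48) - X8 ^+ 4 * X54 + X8 ^+ 3 * Y10 * Y26 ^+ 2 +
      X8 ^+ 5 * Y10 ^+ 2 * Y26);
   (X20 ^+ 3,
    X8 ^+ 3 * X36,
    - (X8 ^+ 2 * X20 ^+ 2) - X4 * X8 ^+ 4 * X20 + X4 ^+ 2 * X48);
   (X20 ^+ 2 * Y22,
    X8 ^+ 2 * Y10 * X36,
    - Y58);
   (X20 * Y22 ^+ 2,
    X8 * Y10 ^+ 2 * X36,
    - Y60);
   (Y22 ^+ 3,
    Y10 ^+ 3 * X36,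
    - (Y10 ^+ 2 * X20 * Y22) - X4 * Y10 * Y22 * Y26 - X4 * X8 * Y10 ^+ 3
      * X20 - X4 ^+ 2 * X54 + X4 ^+ 2 * X8 * Y10 ^+ 2 * Y26);
   (X20 * Y58,
    X8 ^+ 2 * Y26 * X36 + X8 ^+ 4 * Y10 * X36,
    - (X8 * X20 ^+ 2 * Y26) - X4 * Y22 * X48 - X4 * X8 ^+ 3 * X20 * Y26
      - X4 * X8 ^+ 5 * Y10 * X20 + X4 ^+ 2 * X8 * Y10 * X48);
   (X20 * Y60,
    - (X8 * Y10 * Y26 * X36) + X8 ^+ 3 * Y10 ^+ 2 * X36,
    - Y76 + Y10 * X20 ^+ 2 * Y26 - X8 ^+ 2 * Y10 ^+ 2 * X20 ^+ 2 + X4 *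
      X20 * Y26 ^+ 2 - X4 * X8 ^+ 4 * Y10 ^+ 2 * X20 + X4 ^+ 2 *
      Y10 ^+ 2 * X48);
   (X20 * Y64,
    Y26 * Y58 + X8 * Y10 * X20 ^+ 2 * Y26 + X8 ^+ 3 * Y10 ^+ 2 *
      X20 ^+ 2,
    - (Y10 * Y22 * X48) - X8 * X20 * Y26 ^+ 2 - X8 ^+ 3 * Y10 * X20 *
      Y26);
   (X20 * Y76,
    X8 * Y26 ^+ 2 * X36 - X8 ^+ 5 * Y10 ^+ 2 * X36,
    Y22 ^+ 2 * X48 - X8 ^+ 2 * Y10 * X20 ^+ 2 * Y26 + X8 ^+ 4 * Y10 ^+ 2
      * X20 ^+ 2 - X4 * X8 ^+ 2 * X20 * Y26 ^+ 2 + X4 * X8 ^+ 6 *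
      Y10 ^+ 2 * X20 - X4 ^+ 2 * X8 ^+ 2 * Y10 ^+ 2 * X48);
   (Y22 * Y58,
    X8 * Y10 * Y26 * X36 + X8 ^+ 3 * Y10 ^+ 2 * X36,
    - Y76 + Y10 * X20 ^+ 2 * Y26 - X8 ^+ 2 * Y10 ^+ 2 * X20 ^+ 2 + X4 *
      X20 * Y26 ^+ 2 - X4 * X8 ^+ 4 * Y10 ^+ 2 * X20 + X4 ^+ 2 *
      Y10 ^+ 2 * X48);
   (Y22 * Y60,
    - (Y10 ^+ 2 * Y26 * X36) + X8 ^+ 2 * Y10 ^+ 3 * X36,
    X4 * X20 * X54 - X4 * Y22 * Y26 ^+ 2 - X4 * X8 * Y10 ^+ 2 * X20 *
      Y26 - X4 * X8 ^+ 3 * Y10 ^+ 3 * X20 - X4 ^+ 2 * X8 ^+ 2 * X54 +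
      X4 ^+ 2 * X8 * Y10 * Y26 ^+ 2 + X4 ^+ 2 * X8 ^+ 3 * Y10 ^+ 2 *
      Y26);
   (Y22 * Y64,
    - (Y26 * Y60) + X8 ^+ 2 * Y10 ^+ 3 * X20 ^+ 2,
    X8 * X20 * X54 - Y10 * X20 * Y26 ^+ 2 - X8 ^+ 2 * Y10 ^+ 2 * X20 *
      Y26 + X4 * Y10 ^+ 3 * X48 + X4 * X8 ^+ 3 * X54 - X4 * X8 ^+ 2 *
      Y10 * Y26 ^+ 2 - X4 * X8 ^+ 4 * Y10 ^+ 2 * Y26);
   (Y22 * Y76,
    Y10 * Y26 ^+ 2 * X36 - X8 ^+ 4 * Y10 ^+ 3 * X36,
    - (X20 ^+ 2 * X54) + X20 * Y22 * Y26 ^+ 2 + X8 * Y10 ^+ 2 * X20 ^+ 2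
      * Y26 + X8 ^+ 3 * Y10 ^+ 3 * X20 ^+ 2 + X4 * X8 ^+ 5 * Y10 ^+ 3 *
      X20 - X4 ^+ 2 * X8 * Y10 ^+ 3 * X48);
   (X8 * Y58,
    X20 ^+ 2 * Y26 + X8 ^+ 2 * Y10 * X20 ^+ 2,
    X8 ^+ 4 * Y10 * X20 - X4 * Y10 * X48);
   (X8 * Y60,
    - (X20 * Y22 * Y26) + X8 * Y10 ^+ 2 * X20 ^+ 2,
    Y64 + X8 * Y10 * X20 * Y26 + X4 * X8 * Y26 ^+ 2);
   (X8 * Y64,
    X20 * Y26 ^+ 2 - X8 ^+ 2 * Y10 * X20 * Y26 + X8 ^+ 4 * Y10 ^+ 2 *
      X20,
    - (Y10 ^+ 2 * X48) - X8 ^+ 2 * Y26 ^+ 2);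
   (X8 * Y76,
    Y26 * Y58 - X8 * Y10 * X20 ^+ 2 * Y26 - X8 ^+ 3 * Y10 ^+ 2 *
      X20 ^+ 2,
    Y10 * Y22 * X48 + X8 * X20 * Y26 ^+ 2 + X8 ^+ 3 * Y10 * X20 * Y26);
   (Y10 * Y58,
    X20 * Y22 * Y26 + X8 * Y10 ^+ 2 * X20 ^+ 2,
    Y64 + X8 * Y10 * X20 * Y26 + X4 * X8 * Y26 ^+ 2);
   (Y10 * Y60,
    - (Y22 ^+ 2 * Y26) + Y10 ^+ 3 * X20 ^+ 2,
    X8 ^+ 2 * Y10 ^+ 3 * X20 + X4 * X8 * X54 - X4 * Y10 * Y26 ^+ 2 - X4
      * X8 ^+ 2 * Y10 ^+ 2 * Y26);
   (Y10 * Y64,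
    Y22 * Y26 ^+ 2 - X8 * Y10 ^+ 2 * X20 * Y26 + X8 ^+ 3 * Y10 ^+ 3 *
      X20,
    X8 ^+ 2 * X54 + X8 * Y10 * Y26 ^+ 2 - X8 ^+ 3 * Y10 ^+ 2 * Y26);
   (Y10 * Y76,
    - (Y26 * Y60) + Y10 ^+ 2 * X20 ^+ 2 * Y26 - X8 ^+ 2 * Y10 ^+ 3 *
      X20 ^+ 2,
    - (X8 * X20 * X54) - Y10 * X20 * Y26 ^+ 2 + X8 ^+ 2 * Y10 ^+ 2 * X20
      * Y26);
   (Y58 ^+ 2,
    X8 * X20 * Y26 ^+ 2 * X36 - X8 ^+ 3 * Y10 * X20 * Y26 * X36 +
      X8 ^+ 5 * Y10 ^+ 2 * X20 * X36,
    - (X8 ^+ 3 * Y26 ^+ 2 * X36) + X8 ^+ 7 * Y10 ^+ 2 * X36 - X4 * X48 *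
      Y60 - X4 * Y10 ^+ 2 * X20 ^+ 2 * X48 + X4 * X8 ^+ 4 * Y10 *
      X20 ^+ 2 * Y26 - X4 * X8 ^+ 6 * Y10 ^+ 2 * X20 ^+ 2 - X4 ^+ 2 *
      Y10 * X20 * Y26 * X48 + X4 ^+ 2 * X8 ^+ 4 * X20 * Y26 ^+ 2 -
      X4 ^+ 2 * X8 ^+ 8 * Y10 ^+ 2 * X20 - X4 ^+ 3 * Y26 ^+ 2 * X48 +
      X4 ^+ 3 * X8 ^+ 4 * Y10 ^+ 2 * X48);
   (Y58 * Y60,
    - (Y10 * X20 * Y26 ^+ 2 * X36) + X8 ^+ 4 * Y10 ^+ 3 * X20 * X36,
    - (Y10 ^+ 3 * X36 * X48) - X8 ^+ 3 * X36 * X54 + X8 ^+ 2 * Y10 *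
      Y26 ^+ 2 * X36 + X8 ^+ 4 * Y10 ^+ 2 * Y26 * X36 + X8 ^+ 6 *
      Y10 ^+ 3 * X36 - X4 * Y10 ^+ 2 * X20 * Y22 * X48 + X4 * X8 ^+ 2 *
      X20 ^+ 2 * X54 - X4 * X8 * Y10 * X20 ^+ 2 * Y26 ^+ 2 - X4 *
      X8 ^+ 3 * Y10 ^+ 2 * X20 ^+ 2 * Y26 - X4 * X8 ^+ 5 * Y10 ^+ 3 *
      X20 ^+ 2 - X4 ^+ 2 * Y10 * Y22 * Y26 * X48 + X4 ^+ 2 * X8 ^+ 4 *
      X20 * X54 - X4 ^+ 2 * X8 ^+ 3 * Y10 * X20 * Y26 ^+ 2 - X4 ^+ 2 *
      X8 ^+ 5 * Y10 ^+ 2 * X20 * Y26 - X4 ^+ 2 * X8 ^+ 7 * Y10 ^+ 3 *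
      X20 - X4 ^+ 3 * X48 * X54 + X4 ^+ 3 * X8 * Y10 ^+ 2 * Y26 * X48 +
      X4 ^+ 3 * X8 ^+ 3 * Y10 ^+ 3 * X48);
   (Y58 * Y64,
    X8 * Y10 ^+ 3 * X36 * X48 + X8 ^+ 4 * X36 * X54 - X8 ^+ 3 * Y10 *
      Y26 ^+ 2 * X36 - X8 ^+ 5 * Y10 ^+ 2 * Y26 * X36 + X8 ^+ 7 *
      Y10 ^+ 3 * X36,
    - (Y22 ^+ 2 * Y26 * X48) + X8 ^+ 3 * X20 ^+ 2 * X54 - X8 ^+ 2 * Y10
      * X20 ^+ 2 * Y26 ^+ 2 + X8 ^+ 4 * Y10 ^+ 2 * X20 ^+ 2 * Y26 + X4 *
      Y10 ^+ 2 * X20 * Y26 * X48 - X4 * X8 ^+ 5 * X20 * X54 + X4 *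
      X8 ^+ 6 * Y10 ^+ 2 * X20 * Y26 - X4 * X8 ^+ 8 * Y10 ^+ 3 * X20 -
      X4 ^+ 2 * X8 * X48 * X54 - X4 ^+ 2 * Y10 * Y26 ^+ 2 * X48 +
      X4 ^+ 2 * X8 ^+ 2 * Y10 ^+ 2 * Y26 * X48 + X4 ^+ 2 * X8 ^+ 4 *
      Y10 ^+ 3 * X48);
   (Y58 * Y76,
    Y10 ^+ 3 * X20 * X36 * X48 + X8 ^+ 3 * X20 * X36 * X54 + X8 ^+ 4 *
      Y10 ^+ 2 * X20 * Y26 * X36 - X8 ^+ 6 * Y10 ^+ 3 * X20 * X36,
    Y10 ^+ 2 * Y26 * X36 * X48 + X8 ^+ 2 * Y10 ^+ 3 * X36 * X48 - X4 *
      X8 ^+ 4 * X20 ^+ 2 * X54 + X4 * X8 ^+ 3 * Y10 * X20 ^+ 2 *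
      Y26 ^+ 2 + X4 * X8 ^+ 5 * Y10 ^+ 2 * X20 ^+ 2 * Y26 + X4 * X8 ^+ 7
      * Y10 ^+ 3 * X20 ^+ 2 + X4 ^+ 2 * X20 * X48 * X54 - X4 ^+ 2 * Y22
      * Y26 ^+ 2 * X48 - X4 ^+ 2 * X8 * Y10 ^+ 2 * X20 * Y26 * X48 +
      X4 ^+ 2 * X8 ^+ 3 * Y10 ^+ 3 * X20 * X48 - X4 ^+ 3 * X8 ^+ 2 * X48
      * X54 + X4 ^+ 3 * X8 * Y10 * Y26 ^+ 2 * X48 + X4 ^+ 3 * X8 ^+ 3 *
      Y10 ^+ 2 * Y26 * X48);
   (Y60 ^+ 2,
    Y10 * Y22 * Y26 ^+ 2 * X36 + X8 * Y10 ^+ 3 * X20 * Y26 * X36 +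
      X8 ^+ 3 * Y10 ^+ 4 * X20 * X36,
    X8 ^+ 5 * Y10 ^+ 4 * X36 + X4 * X54 * Y58 + X4 * Y10 ^+ 2 * Y22 ^+ 2
      * X48 - X4 * X8 * Y10 * X20 ^+ 2 * X54 - X4 * Y10 ^+ 2 * X20 ^+ 2
      * Y26 ^+ 2 - X4 * X8 ^+ 2 * Y10 ^+ 3 * X20 ^+ 2 * Y26 - X4 *
      X8 ^+ 4 * Y10 ^+ 4 * X20 ^+ 2 - X4 ^+ 2 * X8 ^+ 2 * Y10 ^+ 2 * X20
      * Y26 ^+ 2 - X4 ^+ 2 * X8 ^+ 4 * Y10 ^+ 3 * X20 * Y26 - X4 ^+ 2 *
      X8 ^+ 6 * Y10 ^+ 4 * X20 + X4 ^+ 3 * Y10 ^+ 3 * Y26 * X48 +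
      X4 ^+ 3 * X8 ^+ 2 * Y10 ^+ 4 * X48);
   (Y60 * Y64,
    - (Y10 ^+ 4 * X36 * X48) - X8 ^+ 3 * Y10 * X36 * X54 - X8 ^+ 4 *
      Y10 ^+ 3 * Y26 * X36 + X8 ^+ 6 * Y10 ^+ 4 * X36,
    - (X20 ^+ 2 * Y26 * X54) + X8 ^+ 2 * Y10 * X20 ^+ 2 * X54 - X4 *
      Y10 ^+ 2 * Y22 * Y26 * X48 + X4 * X8 ^+ 2 * X20 * Y26 * X54 + X4 *
      X8 * Y10 ^+ 4 * X20 * X48 - X4 * X8 ^+ 3 * Y10 ^+ 2 * X20 *
      Y26 ^+ 2 - X4 * X8 ^+ 5 * Y10 ^+ 3 * X20 * Y26 - X4 * X8 ^+ 7 *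
      Y10 ^+ 4 * X20 - X4 ^+ 2 * Y10 * X48 * X54 - X4 ^+ 2 * X8 *
      Y10 ^+ 3 * Y26 * X48 + X4 ^+ 2 * X8 ^+ 3 * Y10 ^+ 4 * X48);
   (Y60 * Y76,
    - (Y10 ^+ 3 * Y22 * X36 * X48) - X8 ^+ 2 * Y10 * X20 * X36 * X54 -
      X8 * Y10 ^+ 2 * X20 * Y26 ^+ 2 * X36 - X8 ^+ 3 * Y10 ^+ 3 * X20 *
      Y26 * X36 - X8 ^+ 5 * Y10 ^+ 4 * X20 * X36,
    - (X8 ^+ 2 * Y26 * X36 * X54) - X8 * Y10 ^+ 4 * X36 * X48 + X8 ^+ 4
      * Y10 * X36 * X54 - X4 * Y10 * Y22 ^+ 2 * Y26 * X48 - X4 * X8 ^+ 3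
      * Y10 * X20 ^+ 2 * X54 + X4 * X8 ^+ 2 * Y10 ^+ 2 * X20 ^+ 2 *
      Y26 ^+ 2 + X4 * X8 ^+ 4 * Y10 ^+ 3 * X20 ^+ 2 * Y26 + X4 * X8 ^+ 6
      * Y10 ^+ 4 * X20 ^+ 2 + X4 ^+ 2 * Y22 * X48 * X54 + X4 ^+ 2 *
      Y10 ^+ 3 * X20 * Y26 * X48 + X4 ^+ 2 * X8 ^+ 3 * X20 * Y26 * X54 -
      X4 ^+ 2 * X8 ^+ 5 * Y10 * X20 * X54 - X4 ^+ 3 * X8 * Y10 * X48 *
      X54 - X4 ^+ 3 * Y10 ^+ 2 * Y26 ^+ 2 * X48 - X4 ^+ 3 * X8 ^+ 2 *
      Y10 ^+ 3 * Y26 * X48);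
   (Y64 ^+ 2,
    Y10 * Y22 ^+ 2 * Y26 * X48 + X8 * X20 ^+ 2 * Y26 * X54 - X8 ^+ 2 *
      Y10 ^+ 2 * X20 ^+ 2 * Y26 ^+ 2 + X8 ^+ 4 * Y10 ^+ 3 * X20 ^+ 2 *
      Y26 + X8 ^+ 6 * Y10 ^+ 4 * X20 ^+ 2,
    X8 ^+ 3 * X20 * Y26 * X54 - X8 ^+ 2 * Y10 ^+ 4 * X20 * X48 + X8 ^+ 5
      * Y10 * X20 * X54 - X8 ^+ 4 * Y10 ^+ 2 * X20 * Y26 ^+ 2 - X8 ^+ 6
      * Y10 ^+ 3 * X20 * Y26 - X4 * X8 * Y10 * X48 * X54 - X4 * X8 ^+ 2
      * Y10 ^+ 3 * Y26 * X48 + X4 * X8 ^+ 5 * Y26 * X54 - X4 * X8 ^+ 4 *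
      Y10 ^+ 4 * X48 - X4 * X8 ^+ 7 * Y10 * X54 + X4 * X8 ^+ 8 *
      Y10 ^+ 3 * Y26);
   (Y64 * Y76,
    Y10 ^+ 3 * Y26 * X36 * X48 + X8 ^+ 3 * Y26 * X36 * X54 + X8 ^+ 2 *
      Y10 ^+ 4 * X36 * X48 + X8 ^+ 5 * Y10 * X36 * X54 + X8 ^+ 4 *
      Y10 ^+ 2 * Y26 ^+ 2 * X36 - X8 ^+ 8 * Y10 ^+ 4 * X36,
    Y10 ^+ 2 * X20 * Y22 * Y26 * X48 - X8 ^+ 2 * X20 ^+ 2 * Y26 * X54 -
      X8 * Y10 ^+ 4 * X20 ^+ 2 * X48 + X8 ^+ 3 * Y10 ^+ 2 * X20 ^+ 2 *
      Y26 ^+ 2 + X8 ^+ 5 * Y10 ^+ 3 * X20 ^+ 2 * Y26 + X8 ^+ 7 *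
      Y10 ^+ 4 * X20 ^+ 2 + X4 * Y10 * X20 * X48 * X54 - X4 * X8 *
      Y10 ^+ 3 * X20 * Y26 * X48 + X4 * X8 ^+ 4 * X20 * Y26 * X54 + X4 *
      X8 ^+ 3 * Y10 ^+ 4 * X20 * X48 + X4 * X8 ^+ 6 * Y10 * X20 * X54 +
      X4 * X8 ^+ 5 * Y10 ^+ 2 * X20 * Y26 ^+ 2 + X4 * X8 ^+ 7 * Y10 ^+ 3
      * X20 * Y26 + X4 * X8 ^+ 9 * Y10 ^+ 4 * X20 + X4 ^+ 2 * Y26 * X48
      * X54 - X4 ^+ 2 * X8 * Y10 ^+ 2 * Y26 ^+ 2 * X48 + X4 ^+ 2 *
      X8 ^+ 3 * Y10 ^+ 3 * Y26 * X48 - X4 ^+ 2 * X8 ^+ 5 * Y10 ^+ 4 *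
      X48);
   (Y76 ^+ 2,
    Y10 ^+ 2 * Y22 * Y26 * X36 * X48 + X8 ^+ 2 * X20 * Y26 * X36 * X54 -
      X8 * Y10 ^+ 4 * X20 * X36 * X48 - X8 ^+ 4 * Y10 * X20 * X36 * X54
      + X8 ^+ 3 * Y10 ^+ 2 * X20 * Y26 ^+ 2 * X36 + X8 ^+ 5 * Y10 ^+ 3 *
      X20 * Y26 * X36 + X8 ^+ 7 * Y10 ^+ 4 * X20 * X36,
    X8 * Y10 ^+ 3 * Y26 * X36 * X48 + X8 ^+ 4 * Y26 * X36 * X54 +
      X8 ^+ 3 * Y10 ^+ 4 * X36 * X48 - X8 ^+ 5 * Y10 ^+ 2 * Y26 ^+ 2 *
      X36 - X8 ^+ 7 * Y10 ^+ 3 * Y26 * X36 - X8 ^+ 9 * Y10 ^+ 4 * X36 -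
      X4 * X20 * Y22 * X48 * X54 + X4 * Y22 ^+ 2 * Y26 ^+ 2 * X48 - X4 *
      Y10 ^+ 3 * X20 ^+ 2 * Y26 * X48 - X4 * X8 ^+ 3 * X20 ^+ 2 * Y26 *
      X54 + X4 * X8 ^+ 5 * Y10 * X20 ^+ 2 * X54 - X4 ^+ 2 * Y10 ^+ 2 *
      X20 * Y26 ^+ 2 * X48 - X4 ^+ 2 * X8 ^+ 2 * Y10 ^+ 3 * X20 * Y26 *
      X48 - X4 ^+ 2 * X8 ^+ 5 * X20 * Y26 * X54 + X4 ^+ 2 * X8 ^+ 6 *
      Y10 ^+ 2 * X20 * Y26 ^+ 2 + X4 ^+ 2 * X8 ^+ 8 * Y10 ^+ 3 * X20 *
      Y26 + X4 ^+ 2 * X8 ^+ 10 * Y10 ^+ 4 * X20 - X4 ^+ 3 * Y10 ^+ 4 *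
      X48 ^+ 2 + X4 ^+ 3 * X8 ^+ 3 * Y10 * X48 * X54 - X4 ^+ 3 * X8 ^+ 2
      * Y10 ^+ 2 * Y26 ^+ 2 * X48 + X4 ^+ 3 * X8 ^+ 4 * Y10 ^+ 3 * Y26 *
      X48 - X4 ^+ 3 * X8 ^+ 6 * Y10 ^+ 4 * X48);
   (Y26 ^+ 2 * Y58,
    Y10 ^+ 2 * X20 * Y22 * X48 + X8 ^+ 2 * X20 ^+ 2 * X54 - X8 ^+ 3 *
      Y10 ^+ 2 * X20 ^+ 2 * Y26,
    Y10 * Y22 * Y26 * X48 + X8 ^+ 3 * Y10 * X20 * Y26 ^+ 2);
   (Y26 ^+ 2 * Y60,
    - (Y10 ^+ 2 * Y22 ^+ 2 * X48) - X8 * Y10 * X20 ^+ 2 * X54 - Y10 ^+ 2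
      * X20 ^+ 2 * Y26 ^+ 2 + X8 ^+ 2 * Y10 ^+ 3 * X20 ^+ 2 * Y26,
    - (X8 * X20 * Y26 * X54) + Y10 ^+ 4 * X20 * X48 + X8 ^+ 3 * Y10 *
      X20 * X54 + X8 ^+ 2 * Y10 ^+ 2 * X20 * Y26 ^+ 2 - X8 ^+ 4 *
      Y10 ^+ 3 * X20 * Y26);
   (Y26 * Y76,
    Y10 * Y22 ^+ 2 * X48 + X8 * X20 ^+ 2 * X54 - Y10 * X20 ^+ 2 *
      Y26 ^+ 2 + X8 ^+ 2 * Y10 ^+ 2 * X20 ^+ 2 * Y26,
    Y10 ^+ 3 * X20 * X48 + X8 ^+ 3 * X20 * X54 + X8 ^+ 2 * Y10 * X20 *
      Y26 ^+ 2 - X8 ^+ 4 * Y10 ^+ 2 * X20 * Y26)].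

(** Termination measure of the rewriting: weights of the thirteen generators, chosen so that in each
    rule every monomial of r is lighter than l. *)
Definition rule_weights : seq nat :=
  [:: 0; 0; 0; 1; 3; 3; 0; 0; 0; 10; 10; 14; 14].

Definition mono_of (e : expr) : mono := (head (false, [::]) (norm (svars 13) e)).2.

(** The relation is tested with x4, x8, y10, h12, h16, h18, g24 as independent variables. Only r has
    to be lighter than l: the part x4 * s lies in x4 A and is not rewritten further. *)
Definition rule_ok (r : expr * expr * expr) : bool :=
  let: (l, r0, s) := r in
  let env := [seq norm (svars 7) e | e <- gen_exprs] in
  [&& norm (svars 13) l == [:: (false, mono_of l)],
      norm env l == norm env (r0 + X4 * s) &
      all (fun t => mono_weight rule_weights t.2
                    < mono_weight rule_weights (mono_of l))%N
          (norm (svars 13) r0)].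

Lemma rules_ok : all rule_ok rules.
Proof. by vm_compute. Qed.
End Rules.

(** * Rewriting modulo x4 *)

Definition mnm_of (n : nat) (m : mono) : 'X_{1..n} :=
  [multinom nth 0%N m i | i < n].

Lemma mvalE (R : comNzRingType) (env : seq R) m :
  mval env m = \prod_(i < size env) env`_i ^+ nth 0%N m i.
Proof.
elim: env m => [|x env IH] [|k m] /=; rewrite ?big_ord0 // big_ord_recl /=.
  by rewrite big1 ?mulr1 // => i _; rewrite nth_nil expr0.
by rewrite IH.
Qed.

Lemma mval_mPo (n k : nat) (g : n.-tuple {mpoly 'F_3[k]}) m :
  mval g m = 'X_[mnm_of n m] \mPo g.
Proof.
rewrite mvalE comp_mpolyX size_tuple; apply: eq_bigr => i _.
by rewrite mnmE (tnth_nth 0).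
Qed.

Lemma F3_char : 3%:R = 0 :> 'F_3. Proof. exact: val_inj. Qed.

Lemma char3_mpoly n : 3%:R = 0 :> {mpoly 'F_3[n]}.
Proof. by rewrite -mpolyC_nat F3_char mpolyC0. Qed.

Lemma mono_weightE w m :
  mono_weight w m = (\sum_(i < size w) nth 0 w i * nth 0 m i)%N.
Proof.
elim: w m => [|a w IH] [|k m] /=; rewrite ?big_ord0 // big_ord_recl /=.
  by rewrite big1 ?muln0 // => i _; rewrite ?nth_nil muln0.
by rewrite IH.
Qed.

Section Rewriting.
Variables (n : nat) (env : seq {mpoly 'F_3[n]}).
Hypothesis size_env : size env = 7%N.
Variable G : 13.-tuple {mpoly 'F_3[n]}.
Hypothesis GE : tval G = [seq eval env e | e <- gen_exprs].

Definition lhs_of (r : expr * expr * expr) : 'X_{1..13} :=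
  mnm_of 13 (mono_of r.1.1).

Definition normal (m : 'X_{1..13}) : bool :=
  (m ord0 == 0%N) && all (fun r => ~~ (lhs_of r <= m)%MM) rules.

Definition weight (m : 'X_{1..13}) : nat :=
  (\sum_(i < 13) nth 0 rule_weights i * m i)%N.

Lemma weightD m1 m2 : weight (m1 + m2)%MM = (weight m1 + weight m2)%N.
Proof. by rewrite -big_split; apply: eq_bigr => i _; rewrite mnmDE mulnDr. Qed.

Lemma weight_mono m : weight (mnm_of 13 m) = mono_weight rule_weights m.
Proof. by rewrite mono_weightE; apply: eq_bigr => i _; rewrite mnmE. Qed.

Lemma eval_G e : eval G e = speval env (norm [seq norm (svars 7) e | e <- gen_exprs] e).
Proof.
rewrite speval_norm ?char3_mpoly // GE -map_comp -size_env.
by congr eval; apply: eq_map => e' /=; rewrite -eval_norm ?char3_mpoly.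
Qed.

Lemma eval_mPo e : eval G e = eval [tuple 'X_i | i < 13] e \mPo G.
Proof.
rewrite -[RHS]/(comp_mpoly G (eval _ e)) rmorph_eval; congr eval.
apply: (@eq_from_nth _ 0) => [|i].
  by rewrite size_map !size_tuple.
rewrite size_tuple => lti; rewrite (nth_map 0) ?size_tuple //.
by rewrite (nth_mktuple _ 0 (Ordinal lti)) /= comp_mpolyXU.
Qed.

Definition reducible (f : {mpoly 'F_3[n]}) : Prop :=
  exists2 N, {in msupp N, forall m, normal m} &
  exists Q, f = N \mPo G + tnth G ord0 * (Q \mPo G).

Lemma reducible0 : reducible 0.
Proof.
exists 0; first by move=> m; rewrite msupp0.
by exists 0; rewrite !rmorph0 mulr0 addr0.
Qed.

Lemma reducibleD f g : reducible f -> reducible g -> reducible (f + g).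
Proof.
case=> N1 n1 [Q1 ->] [N2 n2 [Q2 ->]]; exists (N1 + N2).
  by move=> m /msuppD_le; rewrite mem_cat => /orP[/n1|/n2].
by exists (Q1 + Q2); rewrite !rmorphD mulrDr addrACA.
Qed.

Lemma reducibleZ c f : reducible f -> reducible (c *: f).
Proof.
case=> N n1 [Q ->]; exists (c *: N); first by move=> m /msuppZ_le /n1.
by exists (c *: Q); rewrite !comp_mpolyZ scalerDr scalerAr.
Qed.

Lemma reducible_x4M q : reducible (tnth G ord0 * (q \mPo G)).
Proof.
exists 0; first by move=> m; rewrite msupp0.
by exists q; rewrite rmorph0 add0r.
Qed.

(** Induction on [weight]: as the weight is additive, replacing a left-hand side dividing m by
    lighter monomials lowers the weight of the whole product. *)
Lemma reducible_mono m : reducible ('X_[m] \mPo G).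
Proof.
have [k] := ubnP (weight m); elim: k m => // k IH m; rewrite ltnS => le_mk.
have [nm|] := boolP (normal m).
  exists 'X_[m]; first by move=> m'; rewrite msuppX inE => /eqP->.
  by exists 0; rewrite rmorph0 mulr0 addr0.
rewrite negb_and; case/orP=> [m0|].
  have le1 : (U_(ord0) <= m)%MM.
    apply/mnm_lepP => i; rewrite mnm1E; case: eqP => // <-.
    by rewrite lt0n.
  rewrite -(submK le1) mpolyXD rmorphM mulrC /= comp_mpolyXU -tnth_nth.
  exact: reducible_x4M.
rewrite -has_predC; pose dummy := (Var 0, Var 0, Var 0).
case/(has_nthP dummy) => i /(all_nthP dummy rules_ok i).
case: (nth _ _ _) => -[l r0] s /and3P[/eqP l_mono /eqP rel /allP r0_ok].
move/negPn=> dvd_lm; have {dvd_lm} le_lm : (mnm_of 13 (mono_of l) <= m)%MM := dvd_lm.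
have Xl : 'X_[mnm_of 13 (mono_of l)] \mPo G =
    speval G (norm (svars 13) r0) + tnth G ord0 * (eval [tuple 'X_i | i < 13] s \mPo G).
  rewrite -mval_mPo; transitivity (eval G l).
    by rewrite eval_norm ?char3_mpoly // size_tuple l_mono /speval big_seq1 expr0 mul1r.
  rewrite eval_G rel -eval_G /= eval_norm ?char3_mpoly // size_tuple.
  by rewrite -eval_mPo (tnth_nth 0).
rewrite -(submK le_lm) mpolyXD rmorphM mulrC /= Xl mulrDl.
apply: reducibleD; last by rewrite -mulrA -rmorphM; apply: reducible_x4M.
rewrite /speval big_seq mulr_suml.
apply: (big_ind reducible) => [||t /r0_ok lt_t].
- exact: reducible0.
- exact: reducibleD.
rewrite -mulrA mval_mPo -rmorphM -mpolyXD mulr_sign /=; set f := _ \mPo _.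
suff rf : reducible f by case: ifP => // _; rewrite -scaleN1r; apply: reducibleZ.
apply: IH; apply: leq_trans le_mk; rewrite -{2}(submK le_lm) !weightD addnC.
by rewrite ltn_add2l !weight_mono.
Qed.

Lemma reducible_all q : reducible (q \mPo G).
Proof.
elim/mpolyind: q => [|c m p _ _ IH]; first by rewrite rmorph0; apply: reducible0.
rewrite rmorphD /= comp_mpolyZ; apply: reducibleD => //.
exact/reducibleZ/reducible_mono.
Qed.

End Rewriting.

(** * Leading monomials *)

Lemma exists_max (T : eqType) d (O : orderType d) (f : T -> O) (s : seq T) :
  s != [::] -> exists2 x, x \in s & {in s, forall y, (f y <= f x)%O}.
Proof.
elim: s => // x s IH _; have [->|/IH[y ys le_y]] := eqVneq s [::].
  by exists x => [|y]; rewrite inE // => /eqP->.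
have [le_xy|/ltW le_yx] := leP (f x) (f y).
  by exists y => [|z]; rewrite inE ?ys ?orbT // => /predU1P[->|/le_y].
exists x => [|z]; rewrite inE ?eqxx // => /predU1P[->//|/le_y le_zy].
exact: le_trans le_zy le_yx.
Qed.

Section Leads.
Variables (K : idomainType) (k n : nat) (g : k.-tuple {mpoly K[n]}).

Definition lead_mono (m : 'X_{1..k}) : 'X_{1..n} :=
  (\sum_(i < k) mlead (tnth g i) *+ m i)%MM.

(** Nonvanishing is asked only of the factors that occur in m, because the first entry of
    [special_gens], the image of x4, is zero. *)
Lemma mlead_mono (m : 'X_{1..k}) : (forall i, m i != 0%N -> tnth g i != 0) ->
  'X_[m] \mPo g != 0 /\ mlead ('X_[m] \mPo g) = lead_mono m.
Proof.
move=> g_neq0; have nz i : tnth g i ^+ m i != 0.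
  by have [->|/g_neq0] := eqVneq (m i) 0%N; rewrite ?expr0 ?oner_neq0 // => /expf_neq0->.
rewrite comp_mpolyX; split; first by apply/prodf_neq0 => i _.
rewrite mlead_prod //.
apply: eq_bigr => i _; have [->|/g_neq0 /mleadX->//] := eqVneq (m i) 0%N.
by rewrite expr0 mlead1 mulm0n.
Qed.

(** Distinct leading monomials cannot cancel: the largest of them appears in the composite with a
    nonzero coefficient. *)
Lemma comp_mpoly_eq0 N :
    {in msupp N, forall (m : 'X_{1..k}) i, m i != 0%N -> tnth g i != 0} ->
    {in msupp N &, injective lead_mono} ->
  N \mPo g = 0 -> N = 0.
Proof.
move=> g_neq0 lead_inj N0; apply/eqP; rewrite -msupp_eq0; apply: contraT => s_neq0.
have [m0 m0N max_m0] := exists_max lead_mono s_neq0.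
have [nz0 lead0] := mlead_mono (g_neq0 _ m0N).
have := congr1 (mcoeff (lead_mono m0)) N0; rewrite mcoeff0 {1}(mpolyE N) rmorph_sum.
rewrite raddf_sum (bigD1_seq m0) ?msupp_uniq //= comp_mpolyZ mcoeffZ big_seq_cond.
rewrite big1 ?addr0 => [/eqP|m /andP[mN m_neq0]]; last first.
  have [_ leadm] := mlead_mono (g_neq0 _ mN).
  rewrite comp_mpolyZ mcoeffZ (@mcoeff_gt_mlead _ _ ('X_[m] \mPo g)) ?mulr0 //.
  rewrite leadm lt_neqAle max_m0 // andbT.
  by apply: contra m_neq0 => /eqP/(lead_inj _ _ mN m0N)->.
by rewrite mulf_eq0 -lead0 mleadc_eq0 (negPf nz0) orbF mcoeff_eq0 m0N.
Qed.
End Leads.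

Lemma lex_gtP l1 l2 : lex_gt l1 l2 ->
  exists2 i, forall j, (j < i)%N -> nth 0%N l2 j = nth 0%N l1 j
           & (nth 0%N l2 i < nth 0%N l1 i)%N.
Proof.
elim: l1 l2 => [|k1 l1 IH] [|k2 l2] //=.
  have [->|k1_gt0 _] := posnP k1; last by exists 0%N.
  case/IH => i eq_i lt_i; exists i.+1 => [[|j] lt_ji|] //=.
    by rewrite -eq_i // nth_nil.
  by move: lt_i; rewrite nth_nil.
case/orP=> [lt_k|/andP[/eqP-> /IH[i eq_i lt_i]]]; first by exists 0%N.
by exists i.+1 => [[|j] lt_ji|] //=; apply: eq_i.
Qed.

Section SparseLead.
Variable n : nat.

Lemma mdeg_mnm_of l : (size l <= n)%N -> mdeg (mnm_of n l) = sumn l.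
Proof.
move=> le_ln; rewrite mdegE sumnE (big_nth 0%N) big_mkord.
rewrite (big_ord_widen n (fun i => nth 0%N l i)) // [RHS]big_mkcond.
by apply: eq_bigr => i _; rewrite mnmE; case: ltnP => // /(nth_default 0%N).
Qed.

Lemma mono_gt_ltmc l1 l2 : (size l1 <= n)%N -> (size l2 <= n)%N ->
  mono_gt l1 l2 -> (mnm_of n l2 < mnm_of n l1)%O.
Proof.
move=> s1 s2 /orP[lt_d|/andP[/eqP eq_d /lex_gtP[i eq_i lt_i]]].
  by apply: lt_mdeg_ltmc; rewrite !mdeg_mnm_of.
have lt_in : (i < n)%N.
  apply: leq_trans s1; rewrite ltnNge; apply: contraL lt_i => /(nth_default 0%N)->.
  by rewrite ltn0.
apply/ltmcP; first by rewrite !mdeg_mnm_of.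
by exists (Ordinal lt_in) => [j lt_ji|]; rewrite !mnmE; [apply: eq_i|apply: lt_i].
Qed.

(** The head must beat every other term; the length bounds ensure that [mnm_of n] truncates
    nothing. *)
Definition spoly_lead_ok (p : spoly) : bool :=
  if p is (s, m) :: p' then
    (size m <= n)%N && all (fun t => (size t.2 <= n)%N && mono_gt m t.2) p'
  else false.

Lemma mval_X l : mval [tuple ('X_i : {mpoly 'F_3[n]}) | i < n] l = 'X_[mnm_of n l].
Proof. by rewrite mval_mPo comp_mpoly_id. Qed.

Lemma mlead_speval p : spoly_lead_ok p ->
  let f := speval [tuple ('X_i : {mpoly 'F_3[n]}) | i < n] p in
  f != 0 /\ mlead f = mnm_of n (head (false, [::]) p).2.
Proof.
case: p => // -[s m] p /andP[le_mn p_ok] /=; rewrite speval_cons /= mval_X.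
set a := _ * 'X_[_]; set b := speval _ p.
have a_lead : mlead a = mnm_of n m.
  by rewrite /a mulr_sign; case: (s); rewrite ?mleadN mleadXm.
have a_coef : a@_(mnm_of n m) != 0.
  by rewrite /a mulr_sign; case: (s); rewrite ?mcoeffN mcoeffX eqxx ?oppr_eq0 oner_neq0.
have b_coef l : (mnm_of n m <= l)%O -> b@_l = 0.
  move=> le_ml; rewrite raddf_sum big_seq big1 //= => t tp.
  have /andP[le_tn gt_t] := allP p_ok _ tp.
  rewrite mval_X mulr_sign (fun_if (mcoeff l)) mcoeffN mcoeffX.
  have [E|_] := eqVneq; last by rewrite oppr0 if_same.
  by move: (mono_gt_ltmc le_mn le_tn gt_t); rewrite E ltNge le_ml.
have ab_coef : (a + b)@_(mnm_of n m) != 0 by rewrite mcoeffD b_coef // addr0.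
have ab_neq0 : a + b != 0 by apply: contraNneq ab_coef => ->; rewrite mcoeff0.
split=> //; apply/eqP; rewrite eq_le; apply/andP; split; last first.
  by apply: msupp_le_mlead; rewrite mcoeff_msupp.
rewrite leNgt; apply: contraNN ab_neq0 => lt_m; rewrite -mleadc_eq0 mcoeffD.
by rewrite b_coef ?(ltW lt_m) // addr0 mcoeff_gt_mlead // a_lead.
Qed.

End SparseLead.

(** * Specialisation at x4 = 0 *)

Section D5Formulas.
Local Notation T := (Var 0).
Local Notation P1 := (Var 1).
Local Notation P2 := (Var 2).
Local Notation P3 := (Var 3).
Local Notation P4 := (Var 4).
Local Notation C5 := (Var 5).

Definition x8_expr := (P2 - P1 ^+ 2)%X.
Definition y10_expr := (C5 - T * x8_expr - T ^+ 3 * P1)%X.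
Definition h12_expr := (P3 + T * y10_expr - T ^+ 2 * x8_expr - T ^+ 4 * P1)%X.
Definition h16_expr :=
  (P4 + T ^+ 3 * y10_expr - T ^+ 4 * x8_expr - T ^+ 6 * P1)%X.
Definition h18_expr :=
  (T * (h16_expr - x8_expr ^+ 2) + T ^+ 3 * (- h12_expr + P1 * x8_expr)
   + T ^+ 5 * x8_expr - T ^+ 7 * P1 + T ^+ 9)%X.
Definition g24_expr :=
  (- (T ^+ 8 * x8_expr) + T ^+ 7 * y10_expr - T ^+ 6 * P1 ^+ 3
   + T ^+ 6 * P1 * x8_expr + T ^+ 4 * P1 ^+ 2 * x8_expr
   - T ^+ 4 * x8_expr ^+ 2 + T ^+ 3 * h18_expr
   + T ^+ 3 * P1 ^+ 2 * y10_expr - T ^+ 3 * x8_expr * y10_expr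
   + T ^+ 2 * (h12_expr * x8_expr + h16_expr * P1) - T ^+ 2 * y10_expr ^+ 2
   - T * (h12_expr * y10_expr - h18_expr * P1)
   - T * P1 * x8_expr * y10_expr)%X.

Definition d5_exprs : seq expr :=
  [:: P1; x8_expr; y10_expr; h12_expr; h16_expr; h18_expr; g24_expr].
End D5Formulas.

(** The entries of [env] stand for t, p_1, ..., p_4, c_5, in this order. *)
Definition gens_at (R : comNzRingType) (env : seq R) : seq R :=
  [seq eval [seq eval env e | e <- d5_exprs] e | e <- gen_exprs].

Lemma map_rmorph_eval (R S : comNzRingType) (phi : {rmorphism R -> S}) env es :
  [seq phi x | x <- [seq eval env e | e <- es]]
  = [seq eval [seq phi x | x <- env] e | e <- es].
Proof. by rewrite -map_comp; apply: eq_map => e; apply: rmorph_eval. Qed.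

Lemma rmorph_gens_at (R S : comNzRingType) (phi : {rmorphism R -> S}) env :
  [seq phi x | x <- gens_at env] = gens_at [seq phi x | x <- env].
Proof. by rewrite /gens_at !map_rmorph_eval. Qed.

(* Modulo x4 the invariants specialise to F_3[t, x8, y10, h12, h16]; the
   exponents 8 and 2 make h16 and y10 heavy enough for the leading monomials
   of the twelve remaining generators to be as independent as possible. *)
Section Specialisation.
Local Notation H16 := (Var 0 ^+ 8)%X.
Local Notation Y10 := (Var 1 ^+ 2)%X.
Local Notation T := (Var 2).
Local Notation X8 := (Var 3).
Local Notation H12 := (Var 4).

Definition special_exprs : seq expr :=
  [:: T; T - T; X8; H12 - T * Y10 + T ^+ 2 * X8;
      H16 - T ^+ 3 * Y10 + T ^+ 4 * X8; Y10 + T * X8]%X.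
End Specialisation.

Definition gens_norm (es : seq expr) (env : seq spoly) : seq spoly :=
  [seq norm [seq norm env e | e <- d5_exprs] e | e <- es].

Lemma speval_gens_norm (R : comNzRingType) (env : seq R) es ps : 3%:R = 0 :> R ->
  [seq speval env p | p <- gens_norm es ps] =
  [seq eval [seq eval [seq speval env p | p <- ps] e | e <- d5_exprs] e | e <- es].
Proof.
move=> char3; rewrite -map_comp; apply: eq_map => e.
apply: etrans (speval_norm char3 _ _ _) _; congr eval; rewrite -map_comp.
by apply: eq_map => e'; apply: speval_norm.
Qed.

Definition special_spolys : seq spoly := Eval vm_compute in
  gens_norm gen_exprs [seq norm (svars 5) e | e <- special_exprs].

Definition lhs_monos : seq mono := [seq mono_of r.1.1 | r <- rules].

Lemma lem_mnm_of n l (m : 'X_{1..n}) :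
  (mnm_of n l <= m)%MM = all (fun i => nth 0 l i <= nth 0 m i)%N (iota 0 n).
Proof.
apply/mnm_lepP/allP => [le_lm i|le_lm i].
  rewrite mem_iota /= => lt_in; have := le_lm (Ordinal lt_in).
  by rewrite mnmE (mnm_nth 0%N).
rewrite mnmE (mnm_nth 0%N); apply: le_lm.
by rewrite mem_iota /=.
Qed.

(** The left-hand sides read as linear constraints fit for [lia]. Either none of y58, y60, y64, y76
    occurs, or exactly one does, and then x8, y10, x20, y22 are absent. The exponents of x36, x48,
    x54 (indices 6, 7, 8) are free. *)
Lemma normal_shape (m : 'X_{1..13}) : normal m ->
  let w := nth 0%N m in
  w 0%N = 0%N /\
  ((w 9 = 0 /\ w 10 = 0 /\ w 11 = 0 /\ w 12 = 0 /\
    w 5 <= 2 /\ w 3 + w 4 <= 2 /\ (w 1 = 0 \/ w 4 = 0)) \/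
   (w 1 = 0 /\ w 2 = 0 /\ w 3 = 0 /\ w 4 = 0 /\
    ((w 5 <= 1 /\ w 9 + w 10 = 1 /\ w 11 = 0 /\ w 12 = 0) \/
     (w 5 = 0 /\ w 9 = 0 /\ w 10 = 0 /\ w 11 + w 12 = 1))))%N.
Proof.
case/andP; rewrite (mnm_nth 0%N) => /eqP m0.
have -> : all (fun r => ~~ (lhs_of r <= m)%MM) rules =
   all (fun l => ~~ all (fun i => nth 0 l i <= nth 0 m i)%N (iota 0 13)) lhs_monos.
  by rewrite all_map; apply: eq_all => r; rewrite /lhs_of lem_mnm_of.
have -> : lhs_monos = ltac:(let l := eval vm_compute in lhs_monos in exact l) by vm_compute.
move: m0; case: m => m /=; set w := nth 0%N m => w0 rules_w.
split=> //; move: rules_w {w0}.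
move: (w 1) (w 2) (w 3) (w 4) (w 5) (w 9) (w 10) (w 11) (w 12) => {w m}.
move=> A B P Q S U V W Z; rewrite !andbT.
(* Deciding first which of y64, y76, y58, y60 occur simplifies many of the divisibility tests before
   [lia] is called. *)
case: W => [|W]; case: Z => [|Z]; case: U => [|U]; case: V => [|V].
all: rewrite ?ltn0 ?andbF ?andbT /=.
all: lia.
Qed.

Definition special_gens : 13.-tuple {mpoly 'F_3[5]} :=
  [tuple speval [tuple 'X_i | i < 5] (nth [::] special_spolys i) | i < 13].

Definition special_leads : seq mono :=
  [seq (head (false, [::]) p).2 | p <- special_spolys].

(** [behead] skips x4, which specialises to zero and has no leading term. *)
Lemma special_lead_ok : all (spoly_lead_ok 5) (behead special_spolys).
Proof. by vm_compute. Qed.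

Lemma size_special_spolys : size special_spolys = 13%N.
Proof. by []. Qed.

Lemma special_gens_lead (i : 'I_13) :
  (i != 0%N :> nat -> tnth special_gens i != 0) /\
  mlead (tnth special_gens i) = mnm_of 5 (nth [::] special_leads i).
Proof.
rewrite tnth_mktuple (nth_map [::]) ?size_special_spolys ?ltn_ord //.
case: i => -[|i] lti.
  by split=> //; rewrite /speval big_nil mlead0; apply/mnmP => j; rewrite mnm0E mnmE nth_nil.
have lti' : (i < size (behead special_spolys))%N by [].
have /mlead_speval[nz lead_i] := all_nthP [::] special_lead_ok i lti'.
by split=> // _; apply: nz.
Qed.

Lemma special_lead_mono (m : 'X_{1..13}) (j : 'I_5) : lead_mono special_gens m j =
  sumn [seq (nth 0 (nth [::] special_leads i) j * nth 0 m i)%N | i <- iota 0 13].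
Proof.
rewrite mnm_sumE sumnE big_map -[iota 0 13]/(index_iota 0 13) big_mkord.
apply: eq_bigr => i _; case: (special_gens_lead i) => _ ->.
by rewrite mulmnE mnmE (mnm_nth 0%N).
Qed.

(** The five variables give only five linear equations for the twelve exponents; the bounds of
    [normal_shape] restore uniqueness, by integer arithmetic in each of the nine pairs of shapes. *)
Lemma special_lead_inj : {in normal &, injective (lead_mono special_gens)}.
Proof.
move=> m1 m2 /normal_shape n1 /normal_shape n2 eq_lead.
have {eq_lead} eqj j : (j < 5)%N ->
    sumn [seq (nth 0 (nth [::] special_leads i) j * nth 0 m1 i)%N | i <- iota 0 13]
    = sumn [seq (nth 0 (nth [::] special_leads i) j * nth 0 m2 i)%N | i <- iota 0 13].
  by move=> lt5; rewrite -!(special_lead_mono _ (Ordinal lt5)) eq_lead.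
have special_leadsE : special_leads =
  ltac:(let l := eval vm_compute in special_leads in exact l) by vm_compute.
move: (eqj 0%N isT) (eqj 1%N isT) (eqj 2%N isT) (eqj 3%N isT) (eqj 4%N isT).
rewrite special_leadsE /= {eqj special_leadsE} => e0 e1 e2 e3 e4.
suff eqw i : (i < 13)%N -> nth 0%N m1 i = nth 0%N m2 i.
  by apply/mnmP => i; rewrite !(mnm_nth 0%N) eqw.
move: n1 n2 e0 e1 e2 e3 e4 => /=; move: (nth 0%N m1) (nth 0%N m2) => u v.
case=> u0 un [v0 vn] e0 e1 e2 e3 e4.
have : (i < 13)%N -> (u i == v i); last by move=> uv /uv/eqP.
case: un => [un|[u1 [u2 [u3 [u4 [un|un]]]]]];
  case: vn => [vn|[v1 [v2 [v3 [v4 [vn|vn]]]]]];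
  do 13?[case: i => [|i]] => // _; lia.
Qed.

Lemma special_gensE :
  tval special_gens = gens_at [seq eval [tuple 'X_i | i < 5] e | e <- special_exprs].
Proof.
have -> : tval special_gens = [seq speval [tuple 'X_i | i < 5] p | p <- special_spolys].
  apply: (@eq_from_nth _ 0) => [|i]; rewrite size_tuple // => lti.
  by rewrite (nth_mktuple _ 0 (Ordinal lti)) (nth_map [::]).
have -> : special_spolys = gens_norm gen_exprs [seq norm (svars 5) e | e <- special_exprs].
  by vm_compute.
apply: etrans (speval_gens_norm _ _ _ (char3_mpoly 5)) _.
rewrite -[LHS]/(gens_at _); congr gens_at; rewrite -map_comp; apply: eq_map => e.
by apply: etrans _ (esym (eval_norm (char3_mpoly 5) _ _)); rewrite size_tuple.
Qed.

(** Here the six variables are not the weights but formal copies of t, p_1, ..., p_4, c_5, so that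
    this polynomial ring is S. *)
Definition formal_gens : 13.-tuple {mpoly 'F_3[6]} :=
  [tuple (gens_at [tuple ('X_i : {mpoly 'F_3[6]}) | i < 6])`_i | i < 13].

Lemma formal_gensE :
  tval formal_gens = gens_at [tuple ('X_i : {mpoly 'F_3[6]}) | i < 6].
Proof.
apply: (@eq_from_nth _ 0) => [|i]; rewrite size_tuple ?size_map // => lti.
by rewrite (nth_mktuple _ 0 (Ordinal lti)).
Qed.

Lemma map_mPo_X n k (g : n.-tuple {mpoly 'F_3[k]}) :
  [seq f \mPo g | f <- [tuple ('X_i : {mpoly 'F_3[n]}) | i < n]] = g.
Proof.
apply: (@eq_from_nth _ 0) => [|i]; rewrite size_map !size_tuple // => lti.
rewrite (nth_map 0) ?size_tuple // (nth_mktuple _ 0 (Ordinal lti)).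
by rewrite comp_mpolyXU.
Qed.

Lemma comp_mpolyA n k l (q : {mpoly 'F_3[n]}) (g : n.-tuple {mpoly 'F_3[k]})
    (h : k.-tuple {mpoly 'F_3[l]}) (g' : n.-tuple {mpoly 'F_3[l]}) :
  tval g' = [seq f \mPo h | f <- g] -> (q \mPo g) \mPo h = q \mPo g'.
Proof.
move=> g'E; rewrite (comp_mpolyEX q g) (comp_mpolyEX q g') raddf_sum; apply: eq_bigr => m _.
rewrite /= comp_mpolyZ !comp_mpolyX rmorph_prod; congr (_ *: _).
apply: eq_bigr => i _; rewrite rmorphXn /=; congr (_ ^+ _).
by rewrite !(tnth_nth 0) g'E (nth_map 0) ?size_tuple.
Qed.

Lemma normal_x4_free (N : {mpoly 'F_3[13]}) (f : {mpoly 'F_3[6]}) :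
    {in msupp N, forall m, normal m} ->
  N \mPo formal_gens = tnth formal_gens ord0 * f -> N = 0.
Proof.
move=> nN Nf; apply: (@comp_mpoly_eq0 _ _ _ special_gens) => [m /nN|m1 m2 /nN n1 /nN n2|].
- case/andP => /eqP m0 _ i mi; apply: (special_gens_lead i).1.
  by apply: contraNneq mi => i0; rewrite (_ : i = ord0) ?m0 //; apply/val_inj.
- exact: special_lead_inj.
(* [sp] gives t, p_1, ..., p_4, c_5 the values found by setting p_1 = 0 and solving the definitions
   of x8, y10, h12, h16 for p_2, c_5, p_3, p_4. *)
pose sp : 6.-tuple {mpoly 'F_3[5]} :=
  [tuple of [seq eval [tuple 'X_i | i < 5] e | e <- special_exprs]].
have sg : tval special_gens = [seq g \mPo sp | g <- formal_gens].
  by rewrite formal_gensE [RHS](rmorph_gens_at (comp_mpoly sp)) map_mPo_X special_gensE.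
rewrite -(comp_mpolyA _ sg) Nf rmorphM /=.
rewrite -[tnth formal_gens ord0 \mPo sp]/(comp_mpoly sp _).
rewrite (_ : tnth formal_gens ord0 \mPo sp = 0) ?mul0r //.
rewrite tnth_mktuple -[X in X \mPo _]/([tuple ('X_i : {mpoly 'F_3[6]}) | i < 6]`_1).
rewrite (nth_mktuple _ 0 (Ordinal (isT : 1 < 6)%N)) comp_mpolyXU; exact: subrr.
Qed.

(** * Invariants of the subgroup of type D_5 *)

Definition esym_exprs (a b c d e : expr) : seq expr :=
  [:: a + b + c + d + e;
      a * (b + c + d + e) + b * (c + d + e) + c * (d + e) + d * e;
      a * (b * (c + d + e) + c * (d + e) + d * e) + b * (c * (d + e) + d * e)
        + c * d * e;
      a * (b * (c * (d + e) + d * e) + c * d * e) + b * c * d * e;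
      a * b * c * d * e]%X.

Section TorusFormulas.
Local Notation T := (Var 0).
Local Notation T1 := (Var 1).
Local Notation T2 := (Var 2).
Local Notation T3 := (Var 3).
Local Notation T4 := (Var 4).
Local Notation T5 := (Var 5).

(** The fifth symmetric function p_5 is replaced by its square root c_5, which the even sign changes
    of D_5 preserve. *)
Definition torus_exprs : seq expr :=
  T :: rcons (take 4 (esym_exprs (T1 ^+ 2) (T2 ^+ 2) (T3 ^+ 2) (T4 ^+ 2) (T5 ^+ 2)))
             (T1 * T2 * T3 * T4 * T5)%X.

(* The reflections R_2, ..., R_6 in the coordinates t, t_1, ..., t_5. *)
Definition d5_reflections : seq (seq expr) :=
  [:: [:: T; - T2; - T1; T3; T4; T5]; [:: T; T2; T1; T3; T4; T5];
      [:: T; T1; T3; T2; T4; T5]; [:: T; T1; T2; T4; T3; T5];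
      [:: T; T1; T2; T3; T5; T4]]%X.
End TorusFormulas.

Definition subst_tuple (n k : nat) (es : seq expr) : n.-tuple {mpoly 'F_3[k]} :=
  [tuple eval [tuple ('X_i : {mpoly 'F_3[k]}) | i < k] (nth (Var 0) es i) | i < n].

Lemma subst_tupleE n k es : size es = n ->
  tval (subst_tuple n k es) = [seq eval [tuple ('X_i : {mpoly 'F_3[k]}) | i < k] e | e <- es].
Proof.
move=> sz; apply: (@eq_from_nth _ 0) => [|i]; rewrite size_tuple ?size_map // => lti.
by rewrite (nth_mktuple _ 0 (Ordinal lti)) (nth_map (Var 0)) ?sz.
Qed.

Lemma eval_X_mPo n k (g : n.-tuple {mpoly 'F_3[k]}) e :
  eval [tuple ('X_i : {mpoly 'F_3[n]}) | i < n] e \mPo g = eval g e.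
Proof.
rewrite -[LHS]/(comp_mpoly g (eval _ e)) rmorph_eval; congr eval.
exact: map_mPo_X.
Qed.

(** In this copy of the ring the variables are t, t_1, ..., t_5; composing with [torus] returns to
    the weights. *)
Definition d5_gens : 6.-tuple {mpoly 'F_3[6]} := subst_tuple 6 6 torus_exprs.

Definition d5_inv (F : {mpoly 'F_3[6]}) : Prop :=
  forall i, (i < 5)%N -> F \mPo subst_tuple 6 6 (nth [::] d5_reflections i) = F.

Definition torus_spolys : seq spoly := Eval vm_compute in
  [seq norm (svars 6) e | e <- torus_exprs].

Lemma torus_spolysE : torus_spolys = [seq norm (svars 6) e | e <- torus_exprs].
Proof. by vm_compute. Qed.

Lemma d5_gensE (i : 'I_6) :
  tnth d5_gens i = speval [tuple 'X_i | i < 6] (nth [::] torus_spolys i).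
Proof.
rewrite tnth_mktuple eval_norm ?char3_mpoly // size_tuple torus_spolysE.
by rewrite (nth_map (Var 0)) ?ltn_ord.
Qed.

Definition torus_leads : seq mono :=
  [:: [:: 1; 0; 0; 0; 0; 0]; [:: 0; 2; 0; 0; 0; 0]; [:: 0; 2; 2; 0; 0; 0];
      [:: 0; 2; 2; 2; 0; 0]; [:: 0; 2; 2; 2; 2; 0]; [:: 0; 1; 1; 1; 1; 1]]%N.

Lemma torus_leads_ok :
  all (spoly_lead_ok 6) torus_spolys /\
  [seq mnm_of 6 (head (false, [::]) p).2 | p <- torus_spolys]
  = [seq mnm_of 6 l | l <- torus_leads].
Proof.
split; first by vm_compute.
by congr [:: _; _; _; _; _; _]; apply/mnmP => -[[|[|[|[|[|[]]]]]] lti] //; rewrite !mnmE.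
Qed.

Lemma d5_gens_neq0 i : tnth d5_gens i != 0.
Proof.
rewrite d5_gensE; have [/all_nthP ok _] := torus_leads_ok.
by have /mlead_speval[] := ok [::] i (ltn_ord i).
Qed.

Lemma mlead_d5_gens (i : 'I_6) : mlead (tnth d5_gens i) = mnm_of 6 (nth [::] torus_leads i).
Proof.
rewrite d5_gensE; have [/all_nthP ok leadE] := torus_leads_ok.
have /mlead_speval[_ ->] := ok [::] i (ltn_ord i).
have := congr1 (fun s => nth 0%MM s i) leadE.
by rewrite (nth_map [::]) ?ltn_ord // (nth_map [::]) ?ltn_ord.
Qed.

(** Such a substitution permutes the monomials up to sign. As s is its own inverse, s also describes
    the action on exponents. *)
Lemma mcoeff_signed_perm n (s : 'I_n -> 'I_n) (sK : involutive s) (e : 'I_n -> bool)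
    (F : {mpoly 'F_3[n]}) m :
  (F \mPo [tuple (-1) ^+ e i *: 'X_(s i) | i < n])@_m =
  (-1) ^+ (\sum_i e i * m (s i))%N * F@_[multinom m (s i) | i < n].
Proof.
elim/mpolyind: F => [|c k p _ _ IH].
  by rewrite rmorph0 !mcoeff0 mulr0.
rewrite comp_mpolyD [LHS]mcoeffD [in RHS]mcoeffD mulrDr; congr (_ + _); last exact: IH.
rewrite comp_mpolyZ !mcoeffZ.
rewrite comp_mpolyX mulrCA; congr (_ * _).
pose k' : 'X_{1..n} := [multinom k (s i) | i < n].
have -> : \prod_i tnth [tuple (-1) ^+ e i *: 'X_(s i) | i < n] i ^+ k i
    = (-1) ^+ (\sum_i e i * k i)%N *: 'X_[k'] :> {mpoly 'F_3[n]}.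
  transitivity (\prod_i ((-1) ^+ (e i * k i)%N *: 'X_(s i) ^+ k i : {mpoly 'F_3[n]})).
    by apply: eq_bigr => i _; rewrite tnth_mktuple exprZn exprM.
  rewrite scaler_prod -expr_sum; congr (_ *: _).
  rewrite [RHS]mpolyXE_id [RHS](reindex_inj (inv_inj sK)) /=.
  by apply: eq_bigr => i _; rewrite mnmE sK.
rewrite mcoeffZ !mcoeffX.
have -> : (k' == m) = (k == [multinom m (s i) | i < n]).
  by apply/eqP/eqP => [<-|E]; apply/mnmP => i; rewrite !mnmE ?sK // E mnmE sK.
case: eqP => [->|_]; last by rewrite !mulr0.
by congr (_ ^+ _ * _); apply: eq_bigr => i _; rewrite mnmE.
Qed.

Lemma eval_eval_norm (R : comNzRingType) (char3 : 3%:R = 0 :> R) (env : seq R) n r e :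
  size env = n ->
  eval [seq eval env e' | e' <- r] e = speval env (norm [seq norm (svars n) e' | e' <- r] e).
Proof.
move=> <-; rewrite speval_norm // -map_comp; congr eval; apply: eq_map => e'.
by rewrite /= -eval_norm.
Qed.

Definition subst_norm (n : nat) (es1 es2 : seq expr) : seq spoly :=
  [seq norm [seq norm (svars n) e' | e' <- es2] e | e <- es1].

Lemma map_eval_norm (R : comNzRingType) (char3 : 3%:R = 0 :> R) (env : seq R) n es1 es2 :
  size env = n ->
  [seq eval [seq eval env e' | e' <- es2] e | e <- es1]
  = [seq speval env p | p <- subst_norm n es1 es2].
Proof.
by move=> sz; rewrite -map_comp; apply: eq_map => e; apply: eval_eval_norm.
Qed.

Lemma subst_tuple_norm n k l es1 es2 : size es1 = n -> size es2 = k ->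
  [seq f \mPo subst_tuple k l es2 | f <- subst_tuple n k es1] =
  [seq speval [tuple 'X_i | i < l] p | p <- subst_norm l es1 es2].
Proof.
move=> sz1 sz2; rewrite [tval (subst_tuple n k _)]subst_tupleE //.
rewrite [LHS](map_rmorph_eval (comp_mpoly _)) map_mPo_X subst_tupleE //.
by apply: map_eval_norm; [apply: char3_mpoly | rewrite size_tuple].
Qed.

Lemma subst_tuple_comp n k l es1 es2 es3 :
  [&& size es1 == n, size es2 == k, size es3 == n &
      subst_norm l es1 es2 == [seq norm (svars l) e | e <- es3]] ->
  tval (subst_tuple n l es3) = [seq f \mPo subst_tuple k l es2 | f <- subst_tuple n k es1].
Proof.
case/and4P => /eqP sz1 /eqP sz2 /eqP sz3 /eqP check.
rewrite subst_tuple_norm // check subst_tupleE // -map_comp; apply: eq_map => e.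
by apply: etrans (eval_norm (char3_mpoly l) _ _) _; rewrite size_tuple.
Qed.

Lemma d5_gens_inv q : d5_inv (q \mPo d5_gens).
Proof.
move=> i lti; apply/comp_mpolyA/subst_tuple_comp.
by case: i lti => [|[|[|[|[|//]]]]] _; vm_compute.
Qed.

Definition swap_ord (k : nat) (j : 'I_6) : 'I_6 :=
  inord (if j == k :> nat then k.+1 else if j == k.+1 :> nat then k else j).

Lemma swap_ordE k j : (k < 5)%N -> swap_ord k j =
  (if j == k :> nat then k.+1 else if j == k.+1 :> nat then k else j) :> nat.
Proof. by case: j => j ltj ltk; rewrite inordK //=; do 2?case: eqP => ? //; lia. Qed.

Lemma swap_ordK k : (k < 5)%N -> involutive (swap_ord k).
Proof.
move=> ltk j; apply: ord_inj; rewrite !swap_ordE //.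
by case: j => j ltj /=; do !case: ifP; lia.
Qed.

(** [maxn 1 i] because the first two reflections, R_2 and R_3, both exchange t_1 and t_2, the former
    with a change of signs. *)
Lemma d5_reflectionE i : (i < 5)%N ->
  subst_tuple 6 6 (nth [::] d5_reflections i) =
  [tuple (-1) ^+ ((i == 0%N) && (0 < j < 3)%N) *: 'X_(swap_ord (maxn 1 i) j) | j < 6].
Proof.
move=> lti; apply: eq_from_tnth => j; rewrite !tnth_mktuple.
have Xn k (ltk : (k < 6)%N) : [tuple ('X_i : {mpoly 'F_3[6]}) | i < 6]`_k = 'X_(inord k).
  by rewrite (nth_mktuple _ 0 (Ordinal ltk)); congr 'X_ _; apply/val_inj; rewrite /= inordK.
case: j => -[|[|[|[|[|[|//]]]]]] ltj; move: i lti => [|[|[|[|[|//]]]]] lti;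
  by rewrite [LHS]/= Xn //= ?scaleN1r ?scale1r.
Qed.

Section D5Fundamental.
Variable F : {mpoly 'F_3[6]}.
Hypothesis Finv : d5_inv F.

Lemma d5_inv_swap k (m : 'X_{1..6}) : (0 < k < 5)%N ->
  F@_[multinom m (swap_ord k i) | i < 6] = F@_m.
Proof.
case/andP=> k_gt0 ltk; rewrite -{2}(Finv ltk) d5_reflectionE // mcoeff_signed_perm.
  rewrite (maxn_idPr k_gt0) big1 ?expr0 ?mul1r // => i _.
  by rewrite eqn0Ngt k_gt0.
by apply: swap_ordK; rewrite (maxn_idPr k_gt0).
Qed.

(** R_2 and R_3 together change the signs of t_1 and t_2, so the coefficient at m equals itself
    times (-1)^(m_1 + m_2), and 2 is nonzero in F_3. *)
Lemma d5_inv_odd (m : 'X_{1..6}) : F@_m != 0 -> odd (m (inord 1)) = odd (m (inord 2)).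
Proof.
have := Finv (isT : (0 < 5)%N); rewrite d5_reflectionE // => F1.
have := mcoeff_signed_perm (swap_ordK (isT : (1 < 5)%N)) (fun j => (0 < j < 3)%N) F m.
rewrite F1 d5_inv_swap //.
have -> : (\sum_(i < 6) (0 < i < 3) * m (swap_ord 1 i) = m (inord 1) + m (inord 2))%N.
  rewrite !big_ord_recl big_ord0 /= !mul0n !mul1n !add0n !addn0 addnC.
  by congr (m _ + m _)%N.
rewrite -signr_odd oddD; have [//|neq] := eqVneq (odd (m (inord 1))) (odd (m (inord 2))).
rewrite (_ : odd _ (+) odd _); last by case: odd neq; case: odd.
rewrite expr1 mulN1r => /eqP; rewrite -addr_eq0 -mulr2n -mulr_natl mulf_eq0.
by rewrite -[_%:R == 0]/false /= => ->.
Qed.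

Lemma d5_inv_all_odd (m : 'X_{1..6}) k : (0 < k < 6)%N ->
  F@_m != 0 -> odd (m (inord 1)) = odd (m (inord k)).
Proof.
elim: k m => // k IH m; rewrite ltnS => /andP[_ ltk] Fm.
have [->//|k_neq0] := eqVneq k 0%N.
have [->|k_neq1] := eqVneq k 1%N; first exact: d5_inv_odd.
have k15 : (0 < k < 5)%N by lia.
have := IH [multinom m (swap_ord k i) | i < 6]; rewrite d5_inv_swap // !mnmE => H.
rewrite (_ : inord 1 = swap_ord k (inord 1)).
  rewrite H //; last lia.
  by congr (odd (m _)); apply: ord_inj; rewrite swap_ordE ?inordK ?eqxx //; lia.
by apply: ord_inj; rewrite swap_ordE ?inordK //; do ?case: eqP; lia.
Qed.

(** Otherwise exchanging the two exponents would give a larger monomial of the support. *)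
Lemma d5_mlead_sorted k : (0 < k < 5)%N -> F != 0 ->
  (mlead F (inord k.+1) <= mlead F (inord k))%N.
Proof.
move=> k15 F_neq0; rewrite leqNgt; apply/negP => lt_m; set m := mlead F in lt_m.
pose m' := [multinom m (swap_ord k i) | i < 6].
have ltk5 : (k < 5)%N by lia.
have : (m' <= m)%O.
  by apply: msupp_le_mlead; rewrite mcoeff_msupp d5_inv_swap // mleadc_eq0.
rewrite leNgt => /negP[]; apply/ltmcP.
  rewrite !mdegE [LHS](reindex_inj (inv_inj (swap_ordK ltk5))) /=.
  by apply: eq_bigr => i _; rewrite mnmE.
exists (inord k) => [j|]; rewrite ?inordK ?(ltn_trans ltk5) // mnmE.
  move=> lt_jk; congr (m _); apply: ord_inj; rewrite swap_ordE //.
  by do !case: eqP; lia.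
rewrite (_ : swap_ord k _ = inord k.+1) //; apply: ord_inj.
by rewrite swap_ordE // !inordK ?eqxx //; lia.
Qed.
End D5Fundamental.

Lemma d5_lead_monoE (m : 'X_{1..6}) (j : 'I_6) : lead_mono d5_gens m j =
  sumn [seq (nth 0 (nth [::] torus_leads i) j * m (inord i))%N | i <- iota 0 6].
Proof.
rewrite mnm_sumE sumnE big_map -[iota 0 6]/(index_iota 0 6) big_mkord.
by apply: eq_bigr => i _; rewrite mlead_d5_gens mulmnE mnmE inord_val.
Qed.

(** As for symmetric polynomials: the leading exponents of t_1, ..., t_5 decrease and have equal
    parity, hence are those of a monomial in the generators, which is subtracted. *)
Lemma d5_fundamental F : d5_inv F -> exists q, F = q \mPo d5_gens.
Proof.
elim/mleadrect: F => F IH Finv.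
have [->|F_neq0] := eqVneq F 0; first by exists 0; rewrite rmorph0.
set m := mlead F; have Fm : F@_m != 0 by rewrite mleadc_eq0.
(* p_i leads with t_1^2 ... t_i^2 and c_5 with t_1 ... t_5, so c_5 takes the exponent m_5 and p_i
   takes half of m_i - m_(i+1). *)
pose k : 'X_{1..6} := [multinom nth 0 [:: m (inord 0);
  (m (inord 1) - m (inord 2))./2; (m (inord 2) - m (inord 3))./2;
  (m (inord 3) - m (inord 4))./2; (m (inord 4) - m (inord 5))./2; m (inord 5)]%N i | i < 6].
have [X_neq0 X_lead] := mlead_mono (fun i (_ : k i != 0%N) => d5_gens_neq0 i).
set X := 'X_[k] \mPo d5_gens in X_neq0 X_lead.
have {X_lead} X_lead : mlead X = m.
  rewrite X_lead; apply/mnmP => j; rewrite d5_lead_monoE /= !mnmE !inordK //.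
  rewrite -[in RHS](inord_val j).
  have halfE i : (0 < i < 5)%N -> (m (inord i) =
      m (inord i.+1) + 2 * (m (inord i) - m (inord i.+1))./2)%N.
    move=> i15; have le_m := d5_mlead_sorted Finv i15 F_neq0.
    have odd_m : odd (m (inord i)) = odd (m (inord i.+1)).
      by rewrite -!(d5_inv_all_odd Finv _ Fm) //; lia.
    by rewrite mul2n even_halfK ?subnKC // oddB // odd_m addbb.
  have h1 := halfE 1%N isT; have h2 := halfE 2%N isT; have h3 := halfE 3%N isT.
  have h4 := halfE 4%N isT; clear halfE; move: h1 h2 h3 h4.
  by case: j => -[|[|[|[|[|[|//]]]]]] lt_j /=; lia.
pose G := F - (F@_m / X@_m) *: X.
have X_m : X@_m != 0 by rewrite -X_lead mleadc_eq0.
have Gm : G@_m = 0 by rewrite mcoeffB mcoeffZ divfK ?subrr.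
have Ginv : d5_inv G.
  move=> i lti; have Xi := d5_gens_inv 'X_[k] lti.
  by rewrite /G comp_mpolyB comp_mpolyZ (Finv i lti) [X \mPo _]Xi.
suff [q Gq] : exists q, G = q \mPo d5_gens.
  exists (q + (F@_m / X@_m) *: 'X_[k]).
  by rewrite comp_mpolyD comp_mpolyZ -Gq subrK.
have [->|G_neq0] := eqVneq G 0; first by exists 0; rewrite rmorph0.
apply: IH Ginv; rewrite lt_neqAle -/m; apply/andP; split.
  by apply: contra_neq G_neq0 => Gm'; apply/eqP; rewrite -mleadc_eq0 Gm' Gm.
apply: le_trans (mleadB_le _ _) _; rewrite leUx lexx /=.
by rewrite (le_trans (mleadZ_le _ _)) // X_lead.
Qed.

(** The leading exponents form a triangular system, from which the exponents of a monomial in the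
    generators can be recovered. *)
Lemma d5_independent q : q \mPo d5_gens = 0 -> q = 0.
Proof.
apply: comp_mpoly_eq0 => [m _ i _|m1 m2 _ _ eq_lead]; first exact: d5_gens_neq0.
have {}eq_lead (j : 'I_6) := congr1 (fun m : 'X_{1..6} => m j) eq_lead.
have eqm i : (i < 6)%N -> m1 (inord i) = m2 (inord i).
  have := (eq_lead (inord 0), eq_lead (inord 1), eq_lead (inord 2),
    eq_lead (inord 3), eq_lead (inord 4), eq_lead (inord 5)).
  rewrite !d5_lead_monoE !inordK //= => -[[[[[e0 e1] e2] e3] e4] e5].
  by move: i => [|[|[|[|[|[|//]]]]]] _; lia.
by apply/mnmP => i; rewrite -(inord_val i) eqm.
Qed.

(** * The action of W(E_6) *)

Definition act_tuple (w : 'M[int]_6) : 6.-tuple HBT :=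
  [tuple \sum_(k < 6) ((w j k)%:~R : 'F_3) *: 'X_k | j < 6].

Lemma lattice_actM v w f : lattice_act v (lattice_act w f) = lattice_act (w *m v) f.
Proof.
apply: comp_mpolyA; apply: (@eq_from_nth _ 0) => [|j]; first by rewrite size_map !size_tuple.
rewrite size_tuple => ltj; rewrite [RHS](nth_map 0) ?size_tuple //.
rewrite !(nth_mktuple _ 0 (Ordinal ltj)) [RHS]rmorph_sum /=.
under [RHS]eq_bigr => k _.
  rewrite comp_mpolyZ comp_mpolyXU (nth_mktuple _ 0 k) scaler_sumr; over.
rewrite exchange_big /=; apply: eq_bigr => l _.
rewrite mxE rmorph_sum /= scaler_suml; apply: eq_bigr => k _.
by rewrite rmorphM /= scalerA.
Qed.

Lemma lattice_act1 f : lattice_act 1%:M f = f.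
Proof.
rewrite -[RHS]comp_mpoly_id; congr (f \mPo _); apply: eq_from_tnth => j.
rewrite !tnth_mktuple (bigD1 j) //= mxE eqxx scale1r big1 ?addr0 // => k /negPf kj.
by rewrite mxE eq_sym kj scale0r.
Qed.

(** A reflection is 1 - u a with u a column, a a row and a u = 2, so its square is 1 - 2 u a + u (a
    u) a = 1. *)
Lemma E6_reflectionK i : E6_reflection i *m E6_reflection i = 1%:M.
Proof.
pose u : 'cV[int]_6 := delta_mx i 0; pose a : 'rV[int]_6 := \row_k E6_pairing i k.
have -> : E6_reflection i = 1%:M - u *m a.
  by apply/matrixP => j k; rewrite !mxE big_ord1 !mxE andbT.
have au : a *m u = 2%:M.
  apply/matrixP => j k; rewrite !ord1 !mxE (bigD1 i) //= !mxE /E6_pairing !eqxx mulr1.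
  by rewrite big1 ?addr0 // => l /negPf li; rewrite !mxE li mulr0.
rewrite mulmxBl mul1mx mulmxBr mulmx1 -mulmxA (mulmxA a) au mul_scalar_mx.
by rewrite -scalemxAr scaler_nat mulr2n opprB addrK subrK.
Qed.

Lemma weyl_E6_invariantP f :
  (forall i, lattice_act (E6_reflection i) f = f) <-> weyl_E6_invariant f.
Proof.
split=> [fR w|fW i]; last exact/fW/weyl_E6_refl.
(* Invertibility is carried through the induction, since the case of [invmx] cancels w against its
   inverse. *)
suff: weyl_E6 w -> w \in unitmx /\ lattice_act w f = f by move=> H /H[].
elim=> {w} [i||v w _ [vU vf] _ [wU wf]|w _ [wU wf]].
- by split; [case/mulmx1_unit: (E6_reflectionK i) | apply: fR].
- by rewrite unitmx1 lattice_act1.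
- by rewrite unitmx_mul vU wU -lattice_actM vf.
- split; first by rewrite unitmx_inv.
  apply: etrans (congr1 (lattice_act (invmx w)) (esym wf)) _.
  apply: etrans (lattice_actM _ _ _) _; rewrite (mulmxV wU).
  exact: lattice_act1.
Qed.

Definition adjacent (i k : nat) : bool :=
  (i == k) || ((i.+1, k.+1) \in E6_edges) || ((k.+1, i.+1) \in E6_edges).

(* Linear forms are coefficient lists with entries 0, 1, 2. Modulo 3 the Cartan
   integers satisfy - <alpha_i, alpha_k> = 1 if i = k or i and k are joined. *)
Definition reflect_form (i : nat) (l : seq nat) : seq nat :=
  [seq ((nth 0 l k + adjacent i k * nth 0 l i) %% 3)%N | k <- iota 0 6].

Definition unit_form (j : nat) : seq nat := [seq (k == j : nat) | k <- iota 0 6].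

(** In the absence of constants, a coefficient is a repeated addition and the empty sum is
    [Var 0 - Var 0]. *)
Fixpoint lin_expr_from (k : nat) (l : seq nat) : expr :=
  if l is a :: l' then iter a (Add (Var k)) (lin_expr_from k.+1 l')
  else (Var 0 - Var 0)%X.

Definition lin_expr := lin_expr_from 0.

Definition reflection_exprs (i : nat) : seq expr :=
  [seq lin_expr (reflect_form i (unit_form j)) | j <- iota 0 6].

Lemma eval_lin_expr (R : comNzRingType) (env : seq R) l :
  eval env (lin_expr l) = \sum_(k < size l) env`_k *+ nth 0%N l k.
Proof.
suff H n : eval env (lin_expr_from n l) = \sum_(k < size l) env`_(n + k) *+ nth 0%N l k.
  by apply: H.
elim: l n => [|a l IH] n; first by rewrite big_ord0 /= subrr.
rewrite big_ord_recl addn0; under eq_bigr => k _ do rewrite lift0 addnS -addSn /=.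
rewrite -IH /=; elim: a => [|a IHa]; first by rewrite mulr0n add0r.
by rewrite iterS mulrS -addrA -IHa.
Qed.

Lemma E6_reflection_coef (i j k : 'I_6) :
  ((E6_reflection i j k)%:~R : 'F_3) = (nth 0%N (reflect_form i (unit_form j)) k)%:R.
Proof.
rewrite mxE; case: i => -[|[|[|[|[|[|//]]]]]] lti; case: j => -[|[|[|[|[|[|//]]]]]] ltj;
  case: k => -[|[|[|[|[|[|//]]]]]] ltk; apply/val_inj; vm_compute; reflexivity.
Qed.

Lemma act_tupleE (i : 'I_6) :
  act_tuple (E6_reflection i) = subst_tuple 6 6 (reflection_exprs i).
Proof.
apply: eq_from_tnth => j; rewrite !tnth_mktuple (nth_map 0%N) ?size_iota //.
rewrite nth_iota // eval_lin_expr size_map size_iota; apply: eq_bigr => k _.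
by rewrite E6_reflection_coef scaler_nat (nth_mktuple _ 0 k).
Qed.

(** Vieta's formula trades the sum over subsets in [mesym] for coefficients of a product that [ring]
    can expand. *)
Lemma mesym_mPo (cs : 5.-tuple HBT) k : (k < 6)%N ->
  mesym 5 'F_3 k \mPo cs = (-1) ^+ k * (\prod_(c <- cs) ('X - c%:P))`_(5 - k).
Proof.
move=> ltk; rewrite (mroots_coeff cs (Ordinal ltk)) signrMK.
rewrite /mesym (raddf_sum (comp_mpoly cs)) (raddf_sum (meval _)); apply: eq_bigr => h _ /=.
rewrite (rmorph_prod (comp_mpoly cs)) (rmorph_prod (meval _)); apply: eq_bigr => i _ /=.
by rewrite comp_mpolyXU mevalXU (tnth_nth 0).
Qed.

Lemma prod_XsubC5 (R : comNzRingType) (a b c d e : R) :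
  \prod_(x <- [:: a; b; c; d; e]) ('X - x%:P) =
  let s := [seq eval [:: a; b; c; d; e] s | s <-
    esym_exprs (Var 0) (Var 1) (Var 2) (Var 3) (Var 4)] in
  'X^5 - s`_0 *: 'X^4 + s`_1 *: 'X^3 - s`_2 *: 'X^2 + s`_3 *: 'X - (s`_4)%:P.
Proof.
rewrite !big_cons big_nil /= -!mul_polyC !(polyCD, polyCM).
by ring.
Qed.

Lemma mesym_mPoE (a b c d e : HBT) k : (k < 4)%N ->
  mesym 5 'F_3 k.+1 \mPo [tuple a; b; c; d; e] =
  [seq eval [:: a; b; c; d; e] s | s <-
    esym_exprs (Var 0) (Var 1) (Var 2) (Var 3) (Var 4)]`_k.
Proof.
move=> ltk; rewrite mesym_mPo; last lia.
rewrite [\prod_(_ <- _) _](prod_XsubC5 a b c d e); cbv zeta.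
set s := [seq _ | _ <- _].
rewrite !(coefD, coefN, coefZ, coefXn, coefX, coefC).
by case: k ltk => [|[|[|[|//]]]] _; move: (s`_0) (s`_1) (s`_2) (s`_3) (s`_4);
  move=> s0 s1 s2 s3 s4 /=; ring.
Qed.

(** In F_3 the inverse of 2 is -1, which explains the signs of the first weight. *)
Definition torus_forms : seq expr :=
  let B k := Var k in
  [:: B 0; - B 0 + B 1 - B 2; B 0 + B 1 + B 2 - B 3; B 0 + B 3 - B 4;
      B 0 + B 4 - B 5; B 0 + B 5]%X%N.

Definition torus_inv_forms : seq expr :=
  let T k := Var k in let s := (T 1 + T 2 + T 3 + T 4 + T 5)%X%N in
  [:: T 0; - s; - s - T 0 - T 1; T 3 + T 4 + T 5; T 4 + T 5 + T 0; T 5 - T 0]%X%N.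

Definition torus : 6.-tuple HBT := [tuple t; t1; t2; t3; t4; t5].

Lemma torusE : torus = subst_tuple 6 6 torus_forms.
Proof.
have half x : half_F3 *: x = - x :> HBT.
  by rewrite -scaleN1r; congr (_ *: _); apply/val_inj.
have betaE k : (0 < k < 7)%N -> beta k = [tuple ('X_i : HBT) | i < 6]`_k.-1.
  case/andP=> k_gt0 ltk; have ltk6 : (k.-1 < 6)%N by case: k k_gt0 ltk.
  by rewrite (nth_mktuple _ 0 (Ordinal ltk6)); congr 'X_ _; apply/val_inj; rewrite /= inordK.
apply: val_inj; rewrite [RHS]subst_tupleE //=.
by rewrite /t /t1 /t2 /t3 /t4 /t5 !half !betaE //= opprK.
Qed.

Lemma subst_tuple_vars n :
  subst_tuple n n [seq Var i | i <- iota 0 n] = [tuple 'X_i | i < n].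
Proof.
apply: eq_from_tnth => i; rewrite !tnth_mktuple (nth_map 0%N) ?size_iota //.
by rewrite nth_iota //= (nth_mktuple _ 0 i).
Qed.

Lemma mPo_torusK f : (f \mPo torus) \mPo subst_tuple 6 6 torus_inv_forms = f.
Proof.
rewrite -[RHS]comp_mpoly_id torusE; apply: comp_mpolyA.
by rewrite -subst_tuple_vars; apply: subst_tuple_comp; vm_compute.
Qed.

Lemma torus_mPoK f : (f \mPo subst_tuple 6 6 torus_inv_forms) \mPo torus = f.
Proof.
rewrite -[RHS]comp_mpoly_id torusE; apply: comp_mpolyA.
by rewrite -subst_tuple_vars; apply: subst_tuple_comp; vm_compute.
Qed.

Definition d5_tuple : 6.-tuple HBT := [tuple t; p 1; p 2; p 3; p 4; c5].

Lemma d5_tupleE : tval d5_tuple = [seq f \mPo torus | f <- d5_gens].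
Proof.
rewrite [tval d5_gens]subst_tupleE // [RHS](map_rmorph_eval (comp_mpoly _)) map_mPo_X.
rewrite /d5_tuple /p ![mesym 5 'F_3 _ \mPo _]mesym_mPoE //.
Qed.

Lemma mPo_d5_tuple q : q \mPo d5_tuple = (q \mPo d5_gens) \mPo torus.
Proof. by rewrite -(comp_mpolyA _ d5_tupleE). Qed.

Lemma d5_tuple_independent q : q \mPo d5_tuple = 0 -> q = 0.
Proof.
rewrite mPo_d5_tuple => q0; apply: d5_independent.
by rewrite -[LHS]mPo_torusK q0 rmorph0.
Qed.

Lemma torus_act (i : 'I_6) r : size r = 6 ->
    subst_norm 6 torus_forms (reflection_exprs i) = subst_norm 6 r torus_forms ->
  [seq f \mPo act_tuple (E6_reflection i) | f <- torus]
  = [seq f \mPo torus | f <- subst_tuple 6 6 r].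
Proof.
move=> sz_r check; rewrite torusE act_tupleE.
have sz1 : size (reflection_exprs i) = 6 by rewrite size_map size_iota.
have sz2 : size torus_forms = 6 by [].
apply: etrans (subst_tuple_norm 6 sz2 sz1) _.
by rewrite check; apply: esym (subst_tuple_norm 6 sz_r sz2).
Qed.

(** Entry i of [d5_reflections] is R_(i+2), whose index in ['I_6] is i + 1. *)
Lemma torus_reflection i : (i < 5)%N ->
  [seq f \mPo act_tuple (E6_reflection (inord i.+1)) | f <- torus]
  = [seq f \mPo torus | f <- subst_tuple 6 6 (nth [::] d5_reflections i)].
Proof.
move=> lti; apply: torus_act; first by case: i lti => [|[|[|[|[|//]]]]].
rewrite (@inordK 5 i.+1 lti).
by case: i lti => [|[|[|[|[|//]]]]] _; vm_compute.
Qed.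

Lemma weyl_invariant_d5 f : weyl_E6_invariant f -> exists q, f = q \mPo d5_tuple.
Proof.
move/weyl_E6_invariantP => fR; set F := f \mPo subst_tuple 6 6 torus_inv_forms.
have fE : f = F \mPo torus by rewrite torus_mPoK.
suff /d5_fundamental[q Fq] : d5_inv F by exists q; rewrite mPo_d5_tuple -Fq.
have FR i : (F \mPo torus) \mPo act_tuple (E6_reflection i) = F \mPo torus.
  by rewrite -fE; apply: fR.
clearbody F; move=> i lti; apply: (can_inj mPo_torusK).
pose S := subst_tuple 6 6 (nth [::] d5_reflections i).
pose g := [tuple of [seq f \mPo torus | f <- S]].
have gE : tval g = [seq f \mPo torus | f <- S] by [].
rewrite -/S (comp_mpolyA F gE) -(FR (inord i.+1)); apply/esym/comp_mpolyA.
exact: etrans gE (esym (torus_reflection lti)).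
Qed.

(** * The generators and their invariance *)

Section Numerators.
Local Notation X4 := (Var 0).
Local Notation X8 := (Var 1).
Local Notation Y10 := (Var 2).
Local Notation X20 := (Var 3).
Local Notation Y22 := (Var 4).
Local Notation Y26 := (Var 5).
Local Notation X36 := (Var 6).
Local Notation Y58 := (Var 9).
Local Notation Y60 := (Var 10).

(** Entry i uses only generators of index below 9 + i; the induction in [gens_first_reflection]
    rests on this. *)
Definition numerators : seq expr :=
  [:: X36 * X8 ^+ 2 * Y10 - X20 ^+ 2 * Y22;
      X36 * X8 * Y10 ^+ 2 - X20 * Y22 ^+ 2;
      Y58 * Y10 - X20 * Y22 * Y26 - Y22 ^+ 2 * X8 ^+ 3;
      Y58 * Y22 + Y60 * X20 + X20 * Y22 ^+ 2 * X8 ^+ 2]%X.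

(** The division by x4 is exact before h18 and g24 are expanded in t, so normal forms in seven
    variables suffice. *)
Lemma gens_numerator (R : comNzRingType) (env : seq R) i : 3%:R = 0 :> R -> (i < 4)%N ->
  eval (gens_at env) (nth (Var 0) numerators i)
  = (gens_at env)`_0 * (gens_at env)`_(9 + i).
Proof.
move=> char3 lti; rewrite -[RHS]/(eval (gens_at env) (X4 * Var (9 + i))).
rewrite /gens_at; set env' := [seq eval env e | e <- d5_exprs].
rewrite !(eval_eval_norm char3 (n := 7)) //; congr speval.
by case: i lti => [|[|[|[|//]]]] _; vm_compute.
Qed.
End Numerators.

Definition gens : 13.-tuple HBT := [tuple (gens_at d5_tuple)`_i | i < 13].

Lemma gensE : tval gens = gens_at d5_tuple.
Proof.
apply: (@eq_from_nth _ 0) => [|i]; rewrite size_tuple ?size_map // => lti.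
by rewrite (nth_mktuple _ 0 (Ordinal lti)).
Qed.

Lemma formal_gens_mPo : tval gens = [seq f \mPo d5_tuple | f <- formal_gens].
Proof.
apply: etrans gensE _.
apply: etrans _ (esym (congr1 (map (comp_mpoly d5_tuple)) formal_gensE)).
apply: etrans _ (esym (rmorph_gens_at (comp_mpoly d5_tuple) _)).
by rewrite map_mPo_X.
Qed.

Lemma gens0_neq0 : tnth gens ord0 != 0.
Proof.
rewrite (tnth_nth 0) gensE -[_`_0]/(p 1); apply/eqP => p1_0.
have := @d5_tuple_independent 'X_(inord 1).
rewrite comp_mpolyXU inordK // -[_`_1]/(p 1) => /(_ p1_0)/(congr1 (mcoeff U_(inord 1))).
by rewrite mcoeffX eqxx mcoeff0 => /eqP; rewrite oner_eq0.
Qed.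

Lemma gens_at_x4M i : (i < 4)%N ->
  (@FracField.tofrac HBT (eval (gens_at d5_tuple) (nth (Var 0) numerators i)))
    / @FracField.tofrac HBT x4
  = @FracField.tofrac HBT (gens_at d5_tuple)`_(9 + i).
Proof.
move=> lti; have x4_neq0 : @FracField.tofrac HBT x4 != 0.
  rewrite tofrac_eq0; apply: contraNneq gens0_neq0 => x4_0.
  by rewrite (tnth_nth 0) gensE; apply/eqP.
apply: (mulIf x4_neq0); rewrite mulfVK //.
by rewrite (gens_numerator _ (char3_mpoly 6) lti) mulrC tofracM.
Qed.

Lemma gens_tofrac : [seq @FracField.tofrac _ x | x <- gens] = E6_generators.
Proof.
apply: etrans (congr1 (map (@FracField.tofrac HBT)) gensE) _.
have e58 : y58 = @FracField.tofrac HBT (gens_at d5_tuple)`_9.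
  exact: (gens_at_x4M (i := 0)).
have e60 : y60 = @FracField.tofrac HBT (gens_at d5_tuple)`_10.
  exact: (gens_at_x4M (i := 1)).
have e64 : y64 = @FracField.tofrac HBT (gens_at d5_tuple)`_11.
  rewrite /y64 e58 -tofracM -!tofracB; exact: (gens_at_x4M (i := 2)).
have e76 : y76 = @FracField.tofrac HBT (gens_at d5_tuple)`_12.
  have linE (a b c d e : HBT) : a%:F * b%:F + c%:F * d%:F + e%:F = (a * b + c * d + e)%:F.
    by rewrite !tofracD !tofracM.
  rewrite /y76 e58 e60.
  exact: etrans (congr1 (fun f => f / x4%:F) (linE _ _ _ _ _)) (gens_at_x4M (i := 3) isT).
by rewrite /E6_generators e58 e60 e64 e76.
Qed.

Lemma d5_tuple_reflection i q : (i < 5)%N ->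
  lattice_act (E6_reflection (inord i.+1)) (q \mPo d5_tuple) = q \mPo d5_tuple.
Proof.
move=> lti; rewrite mPo_d5_tuple; move: (d5_gens_inv q lti).
move: (q \mPo d5_gens) => F Finv; pose S := subst_tuple 6 6 (nth [::] d5_reflections i).
pose g := [tuple of [seq f \mPo torus | f <- S]].
have gE : tval g = [seq f \mPo torus | f <- S] by [].
rewrite -[in RHS]Finv (comp_mpolyA F gE); apply: comp_mpolyA.
exact: etrans gE (esym (torus_reflection lti)).
Qed.

(* The reflection R_1 maps t to t - e_1(u) and u_i to u_i - e_1(u), where
   u = (- t_1, t_2, ..., t_5), so its effect on invariants can be computed from
   t and the elementary symmetric functions of u. *)
Section FirstReflection.
Local Notation T := (Var 0).
Local Notation E1 := (Var 1).
Local Notation E2 := (Var 2).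
Local Notation E3 := (Var 3).
Local Notation E4 := (Var 4).
Local Notation E5 := (Var 5).

Definition u_sym_exprs : seq expr :=
  T :: esym_exprs (- Var 1) (Var 2) (Var 3) (Var 4) (Var 5).

(** Each p_i is read off the product of all (X - u_j)(X + u_j), with 2 = -1; the sign in u_1 = - t_1
    turns c_5 into - e_5. *)
Definition d5_of_sym : seq expr :=
  [:: T; E1 ^+ 2 + E2; E2 ^+ 2 + E1 * E3 - E4; E3 ^+ 2 + E2 * E4 - E1 * E5;
      E4 ^+ 2 + E3 * E5; - E5]%X.

(** Elementary symmetric functions of the five shifted variables u_j - e_1, with binomial
    coefficients reduced modulo 3. *)
Definition reflected_sym : seq expr :=
  [:: T - E1;
      - E1;
      E2;
      E3 - E1 ^+ 3;
      E4 + E1 * E3 + E1 ^+ 4;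
      E5 - E1 * E4 + E1 ^+ 2 * E3 - E1 ^+ 3 * E2]%X.

Definition first_reflection : seq expr :=
  let s := (- Var 1 + Var 2 + Var 3 + Var 4 + Var 5)%X in
  [:: T - s; Var 1 + s; Var 2 - s; Var 3 - s; Var 4 - s; Var 5 - s]%X.
End FirstReflection.

Fixpoint vars_below (k : nat) (e : expr) : bool :=
  match e with
  | Var i => (i < k)%N
  | Add e1 e2 | Mul e1 e2 => vars_below k e1 && vars_below k e2
  | Opp e1 | Pow e1 _ => vars_below k e1
  end.

Lemma eval_congr (R : comNzRingType) (env env' : seq R) k e :
  (forall i, (i < k)%N -> env`_i = env'`_i) -> vars_below k e ->
  eval env e = eval env' e.
Proof.
move=> eq_env; elim: e => /= [i /eq_env//|e1 IH1 e2 IH2|e1 IH|e1 IH1 e2 IH2|e1 IH n].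
- by case/andP=> /IH1-> /IH2->.
- by move/IH->.
- by case/andP=> /IH1-> /IH2->.
- by move/IH->.
Qed.

Lemma d5_tuple_eval : tval d5_tuple = [seq eval torus e | e <- torus_exprs].
Proof.
apply: etrans d5_tupleE _.
have -> : tval d5_gens = [seq eval [tuple 'X_i | i < 6] e | e <- torus_exprs].
  exact: subst_tupleE.
by apply: etrans (map_rmorph_eval (comp_mpoly torus) _ _) _; rewrite map_mPo_X.
Qed.

Section FirstReflectionAction.
Let phi : {rmorphism HBT -> HBT} := comp_mpoly (act_tuple (E6_reflection ord0)).
Let u_sym : seq HBT := [seq eval torus e | e <- u_sym_exprs].

Let char3 : 3%:R = 0 :> HBT := char3_mpoly 6.

Let d5_tuple_sym : tval d5_tuple = [seq eval u_sym e | e <- d5_of_sym].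
Proof.
apply: etrans d5_tuple_eval _; apply: etrans _ (esym (map_eval_norm char3 _ _ (size_tuple torus))).
have -> : subst_norm 6 d5_of_sym u_sym_exprs = [seq norm (svars 6) e | e <- torus_exprs].
  by vm_compute.
rewrite -map_comp; apply: eq_map => e; apply: etrans (eval_norm char3 _ _) _.
by rewrite size_tuple.
Qed.

Let phi_u_sym : [seq phi f | f <- u_sym] = [seq eval u_sym e | e <- reflected_sym].
Proof.
have phi_torus : [seq phi f | f <- torus] = [seq eval torus e | e <- first_reflection].
  have sz : size first_reflection = 6 by [].
  have check : subst_norm 6 torus_forms (reflection_exprs (ord0 : 'I_6)) =
      subst_norm 6 first_reflection torus_forms by vm_compute.
  apply: etrans (torus_act sz check) _.
  apply: etrans (congr1 (map (comp_mpoly torus)) (subst_tupleE 6 sz)) _.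
  by apply: etrans (map_rmorph_eval (comp_mpoly torus) _ _) _; rewrite map_mPo_X.
apply: etrans (map_rmorph_eval phi _ _) _; rewrite phi_torus.
apply: etrans (map_eval_norm char3 _ _ (size_tuple torus)) _.
apply: etrans _ (esym (map_eval_norm char3 _ _ (size_tuple torus))).
have check : subst_norm 6 u_sym_exprs first_reflection =
    subst_norm 6 reflected_sym u_sym_exprs by vm_compute.
exact: congr1 check.
Qed.

Let phi_gens_low i : (i < 9)%N -> phi gens`_i = gens`_i.
Proof.
move=> lti; rewrite gensE.
have size_gens : (i < size (gens_at d5_tuple))%N by apply: leq_trans lti _.
rewrite -(nth_map 0 0 phi size_gens) rmorph_gens_at d5_tuple_sym map_rmorph_eval phi_u_sym.
have low ps : (gens_at [seq speval u_sym p | p <- ps])`_i =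
    [seq speval u_sym p | p <- gens_norm (take 9 gen_exprs) ps]`_i.
  by rewrite (speval_gens_norm _ _ _ char3) map_take nth_take.
have sz : size u_sym = 6%N by [].
have symE : [seq eval u_sym e | e <- d5_of_sym] =
    [seq speval u_sym p | p <- [seq norm (svars 6) e | e <- d5_of_sym]].
  by rewrite -map_comp; apply: eq_map => e; apply: (eval_norm char3).
pose at_i env : HBT := (gens_at env)`_i.
apply: etrans (congr1 at_i (map_eval_norm char3 _ _ sz)) _.
apply: etrans (low _) _; apply: etrans _ (esym (congr1 at_i symE)).
apply: etrans _ (esym (low _)).
have check : gens_norm (take 9 gen_exprs) (subst_norm 6 d5_of_sym reflected_sym) =
  gens_norm (take 9 gen_exprs) [seq norm (svars 6) e | e <- d5_of_sym] by vm_compute.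
by move: check; move: (gens_norm _ (subst_norm _ _ _)) => ps ->.
Qed.

(** Nine generators are expanded in [phi_gens_low]. Each of the other four, multiplied by x4, is a
    polynomial in generators already known to be fixed, and x4 cancels in a domain. *)
Lemma gens_first_reflection i : (i < 13)%N -> phi gens`_i = gens`_i.
Proof.
have x4_neq0 : gens`_0 != 0 by rewrite -(tnth_nth 0 gens ord0) gens0_neq0.
have num j : (j < 4)%N ->
    eval gens (nth (Var 0) numerators j) = gens`_0 * gens`_(9 + j).
  by move=> ltj; rewrite gensE (gens_numerator _ char3 ltj).
elim/ltn_ind: i => i IH lti; have [lt9|le9] := ltnP i 9; first exact: phi_gens_low.
have ltj : (i - 9 < 4)%N by lia.
rewrite -(subnKC le9); apply: (mulfI x4_neq0).
rewrite -{1}(phi_gens_low (isT : 0 < 9)%N) -rmorphM -(num _ ltj) rmorph_eval.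
apply: (@eval_congr _ _ _ i) => [k ltk|].
  by rewrite (nth_map 0) ?size_tuple ?IH // (ltn_trans ltk).
have : all (fun k => vars_below (9 + k) (nth (Var 0) numerators k)) (iota 0 4).
  by vm_compute.
move/allP/(_ (i - 9)%N); rewrite mem_iota subnKC //; exact.
Qed.
End FirstReflectionAction.

Lemma gens_invariant q : weyl_E6_invariant (q \mPo gens).
Proof.
apply/weyl_E6_invariantP => i.
case: (unliftP ord0 i) => [j ->|->].
  rewrite -(comp_mpolyA _ formal_gens_mPo).
  rewrite (_ : lift ord0 j = inord j.+1); first exact: d5_tuple_reflection.
  by apply: ord_inj; rewrite inordK ?lift0 // ltnS.
apply: comp_mpolyA; apply: (@eq_from_nth _ 0) => [|k]; first by rewrite size_map !size_tuple.
rewrite size_tuple => ltk; rewrite [RHS](nth_map 0) ?size_tuple //.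
exact: esym (gens_first_reflection ltk).
Qed.

(** * The conjugates of t *)

(* Sixteen rounds of simple reflections exhaust the W(E6)-orbit of t. *)
Definition orbit : seq (seq nat) := Eval vm_compute in
  iter 16 (fun ls => ls ++ undup [seq l <- [seq reflect_form i l | l <- ls, i <- iota 0 6]
                                 | l \notin ls]) [:: unit_form 0].

Definition lin_form (k : nat) : HBT :=
  eval [tuple 'X_i | i < 6] (lin_expr (nth [::] orbit k)).

(** All that the determinant argument uses of a group element, so that no word in the reflections is
    recorded. *)
Definition weyl_fixing (g : 6.-tuple HBT) : Prop :=
  forall f, weyl_E6_invariant f -> f \mPo g = f.

Lemma lin_form_conj k : (k < 27)%N -> exists2 g, weyl_fixing g & t \mPo g = lin_form k.
Proof.
(* Every form of the list after the first is a simple reflection of an earlier one, so the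
   substitutions are built by composition. *)
have step : all (fun k => has (fun k' => has (fun i =>
    subst_norm 6 [:: lin_expr (nth [::] orbit k')] (reflection_exprs i)
    == [:: norm (svars 6) (lin_expr (nth [::] orbit k))])
    (iota 0 6)) (iota 0 k)) (iota 1 26) by vm_compute.
elim/ltn_ind: k => -[|k] IH ltk.
  exists [tuple 'X_i | i < 6] => [f _|]; first exact: comp_mpoly_id.
  rewrite comp_mpoly_id.
  rewrite /lin_form /= subrr addr0 (nth_mktuple _ 0 (ord0 : 'I_6)).
  by congr 'X_ _; apply: ord_inj; rewrite inordK.
have /(allP step) : k.+1 \in iota 1 26 by rewrite mem_iota.
case/hasP=> k'; rewrite mem_iota add0n => /andP[_ ltk'].
case/hasP=> i; rewrite mem_iota add0n => /andP[_ lti] /eqP[check].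
have [g g_fix gE] := IH k' ltk' (ltn_trans ltk' ltk).
pose a := act_tuple (E6_reflection (inord i)).
pose g' := [tuple of [seq f \mPo a | f <- g]].
have g'E : tval g' = [seq f \mPo a | f <- g] by [].
exists g' => [f f_inv|].
  rewrite -(comp_mpolyA f g'E) (g_fix f f_inv).
  by case: (weyl_E6_invariantP f) => _; apply.
rewrite -(comp_mpolyA t g'E) gE /lin_form eval_X_mPo /a act_tupleE (@inordK 5 i lti).
have sz : size (reflection_exprs i) = 6%N by rewrite size_map size_iota.
rewrite (subst_tupleE 6 sz) (eval_eval_norm (char3_mpoly 6) _ _ (size_tuple _)) check.
by apply: esym; apply: etrans (eval_norm (char3_mpoly 6) _ _) _; rewrite size_tuple.
Qed.

(** The conjugates remain distinct modulo 3: each difference has a normal form with a leading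
    term. *)
Lemma lin_form_inj i j : (i < j < 27)%N -> lin_form j - lin_form i != 0.
Proof.
have check : all (fun j => all (fun i => spoly_lead_ok 6 (norm (svars 6)
    (lin_expr (nth [::] orbit j) - lin_expr (nth [::] orbit i))%X)) (iota 0 j)) (iota 0 27).
  by vm_compute.
case/andP=> lt_ij lt_j; have /(allP check) : j \in iota 0 27 by rewrite mem_iota.
move/allP/(_ i); rewrite mem_iota => /(_ lt_ij) /mlead_speval[].
rewrite (_ : speval _ _ = lin_form j - lin_form i) //.
have := eval_norm (char3_mpoly 6) [tuple ('X_i : HBT) | i < 6]
  (lin_expr (nth [::] orbit j) - lin_expr (nth [::] orbit i))%X.
by rewrite size_tuple => <-.
Qed.

(** * Localisation at x4 *)

Section Tower.
Local Notation X4 := (Var 0).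
Local Notation X8 := (Var 1).
Local Notation Y10 := (Var 2).
Local Notation X20 := (Var 3).
Local Notation Y22 := (Var 4).
Local Notation X36 := (Var 6).

(* A triple (c, i, j) stands for c t^i h12^j. The first list expresses x4 t^9
   (the definition of h18 times x4), the second one x4 h12^3 (the definition of
   x36 times x4); h16 and h18 are eliminated by means of x20 and y22. *)
Definition tower_rules : seq (nat * nat * seq (expr * nat * nat)) :=
  [:: (9, 0, [:: (- Y22, 0, 0); (Y10, 0, 1); (X4 * X8 ^+ 2 - X20, 1, 0); (X8, 1, 1);
                 (- (X4 ^+ 2 * X8), 3, 0); (X4, 3, 1); (- (X4 * X8), 5, 0);
                 (X4 ^+ 2, 7, 0)]);
      (0, 3, [:: (X4 * X36, 0, 0);
                 (X4 ^+ 2 * X20 - X4 ^+ 3 * X8 ^+ 2, 0, 1);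
                 (X4 ^+ 2 * X8, 0, 2);
                 (- (X4 ^+ 4 * Y22) - X4 ^+ 5 * X8 * Y10, 1, 0);
                 (X4 ^+ 4 * X20 - X4 ^+ 4 * Y10 ^+ 2, 2, 0);
                 (X4 ^+ 6 * Y10 - X4 ^+ 4 * X8 * Y10 - X4 ^+ 3 * Y22, 3, 0);
                 (X4 ^+ 3 * Y10, 3, 1);
                 (X4 ^+ 6 * X8 - X4 ^+ 4 * X8 ^+ 2, 4, 0);
                 (X4 ^+ 5 * X8 - X4 ^+ 7, 6, 0);
                 (X4 ^+ 4 * Y10, 7, 0);
                 (- (X4 ^+ 4 * X8), 8, 0)])]%X%N.
End Tower.

Definition terms_norm (gs : seq spoly) (r : seq (expr * nat * nat)) : spoly :=
  let env := [:: norm (svars 6) (Var 0); norm (svars 6) h12_expr] in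
  foldr (fun x => sadd (smul (norm gs x.1.1) (norm env (Var 0 ^+ x.1.2 * Var 1 ^+ x.2)%X)))
    [::] r.

Definition low_gens : seq spoly := gens_norm (take 7 gen_exprs) (svars 6).

(** Giving t^i h12^j the weight i + 5 j makes both rules decrease: the heaviest terms are t^3 h12 of
    weight 8 against t^9, and h12^2 of weight 10 against h12^3. *)
Lemma tower_rules_ok : all (fun r =>
    (terms_norm low_gens [:: (Var 0, r.1.1, r.1.2)] == terms_norm low_gens r.2)
    && all (fun x => [&& vars_below 7 x.1.1 & x.1.2 + 5 * x.2 < r.1.1 + 5 * r.1.2]%N) r.2)
  tower_rules.
Proof. by vm_compute. Qed.

Definition tower_mono (i j : nat) : HBT := t ^+ i * h12 ^+ j.

Lemma speval_low_gens : [seq speval d5_tuple p | p <- low_gens] = take 7 gens.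
Proof.
apply: etrans (speval_gens_norm _ _ _ (char3_mpoly 6)) _.
have -> : [seq speval d5_tuple p | p <- svars 6] = d5_tuple by apply: speval_vars.
by rewrite gensE map_take.
Qed.

Lemma speval_terms r : all (fun x => vars_below 7 x.1.1) r ->
  speval d5_tuple (terms_norm low_gens r)
  = \sum_(x <- r) eval gens x.1.1 * tower_mono x.1.2 x.2.
Proof.
have char3 := char3_mpoly 6.
elim: r => [|x r IH]; first by rewrite /speval !big_nil.
case/andP=> x_low r_low; rewrite big_cons -(IH r_low).
apply: etrans (speval_add char3 _ _ _) _; congr (_ + _).
apply: etrans (speval_mul char3 _ _ _) _; congr (_ * _).
  apply: etrans (speval_norm char3 _ _ _) _; rewrite speval_low_gens.
  by apply: eval_congr x_low => i lti; rewrite nth_take.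
apply: etrans (speval_norm char3 _ _ _) _.
have t_norm : speval d5_tuple (norm (svars 6) (Var 0)) = t.
  exact: esym (eval_norm char3 d5_tuple (Var 0)).
have h_norm : speval d5_tuple (norm (svars 6) h12_expr) = h12.
  exact: esym (eval_norm char3 d5_tuple h12_expr).
have -> // : [seq speval d5_tuple p | p <- [:: norm (svars 6) (Var 0); norm (svars 6) h12_expr]]
  = [:: t; h12].
by congr [:: _; _].
Qed.

Definition tower_rule (k : nat) := nth (0, 0, [::])%N tower_rules k.

Lemma tower_relation k (r := tower_rule k) : (k < 2)%N ->
  gens`_0 * tower_mono r.1.1 r.1.2 = \sum_(x <- r.2) eval gens x.1.1 * tower_mono x.1.2 x.2.
Proof.
move=> ltk; have /andP[/eqP check /allP low] := all_nthP (0, 0, [::])%N tower_rules_ok k ltk.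
rewrite -speval_terms; last by apply/allP => x /low/andP[].
rewrite -check speval_terms; last by [].
by rewrite big_seq1.
Qed.

Section LocalizedSpan.
Variables (A R : comNzRingType) (phi : {rmorphism A -> R}) (x : A) (n : nat).
Variable b : 'I_n -> R.

(** Membership in the span of b over A with x inverted, expressed without fractions. *)
Definition localized_span (f : R) : Prop :=
  exists k (c : 'I_n -> A), phi x ^+ k * f = \sum_s phi (c s) * b s.

Lemma localized_spanD f g :
  localized_span f -> localized_span g -> localized_span (f + g).
Proof.
case=> k [c fE] [l [d gE]]; exists (k + l)%N, (fun s => x ^+ l * c s + x ^+ k * d s).
have -> : phi x ^+ (k + l) * (f + g) =
    phi x ^+ l * (phi x ^+ k * f) + phi x ^+ k * (phi x ^+ l * g).
  by rewrite exprD mulrDr !mulrA [_ ^+ l * _ ^+ k]mulrC.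
rewrite fE gE !mulr_sumr -big_split; apply: eq_bigr => s _.
by rewrite rmorphD !rmorphM !rmorphXn mulrDl !mulrA.
Qed.

Lemma localized_span0 : localized_span 0.
Proof.
by exists 0%N, (fun _ => 0); rewrite mulr0 big1 // => s _; rewrite rmorph0 mul0r.
Qed.

Lemma localized_spanM a f : localized_span f -> localized_span (phi a * f).
Proof.
case=> k [c fE]; exists k, (fun s => a * c s).
rewrite mulrCA fE mulr_sumr; apply: eq_bigr => s _.
by rewrite rmorphM mulrA.
Qed.

Lemma localized_spanVx f : localized_span (phi x * f) -> localized_span f.
Proof. by case=> k [c fE]; exists k.+1, c; rewrite exprSr -mulrA. Qed.

Lemma localized_span_b s : localized_span (b s).
Proof.
exists 0%N, (fun s' => (s' == s)%:R); rewrite mul1r (bigD1 s) //= eqxx rmorph1 mul1r.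
by rewrite big1 ?addr0 // => s' /negPf->; rewrite rmorph0 mul0r.
Qed.

Lemma localized_span_sum (I : eqType) (r : seq I) (F : I -> R) :
  {in r, forall i, localized_span (F i)} -> localized_span (\sum_(i <- r) F i).
Proof.
move=> spanF; rewrite big_seq; apply: (big_ind localized_span) => //.
- exact: localized_span0.
- exact: localized_spanD.
Qed.

Lemma localized_span_stable e : (forall s, localized_span (e * b s)) ->
  forall f, localized_span f -> localized_span (e * f).
Proof.
move=> eb f [k [c fE]]; suff [l [d E]] : localized_span (phi x ^+ k * (e * f)).
  by exists (l + k)%N, d; rewrite exprD -mulrA.
rewrite mulrCA fE mulr_sumr; apply: localized_span_sum => s _.
by rewrite mulrCA; apply: localized_spanM.
Qed.

(** These multipliers are closed under sums and products. Once t, the p_i and c_5 are among them,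
    applying a multiplier to 1 puts all of S into the span. *)
Definition span_stable (e : R) : Prop :=
  forall f, localized_span f -> localized_span (e * f).

Lemma span_stable1 : span_stable 1.
Proof. by move=> f; rewrite mul1r. Qed.

Lemma span_stable_phi a : span_stable (phi a).
Proof. exact: localized_spanM. Qed.

Lemma span_stableM e1 e2 : span_stable e1 -> span_stable e2 -> span_stable (e1 * e2).
Proof. by move=> s1 s2 f /s2/s1; rewrite mulrA. Qed.

Lemma span_stableX e k : span_stable e -> span_stable (e ^+ k).
Proof.
move=> se; elim: k => [|k IH]; first exact: span_stable1.
by rewrite exprS; apply: span_stableM.
Qed.

Lemma span_stableD e1 e2 : span_stable e1 -> span_stable e2 -> span_stable (e1 + e2).
Proof. by move=> s1 s2 f sf; rewrite mulrDl; apply: localized_spanD; auto. Qed.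

Lemma span_stableB e1 e2 : span_stable e1 -> span_stable e2 -> span_stable (e1 - e2).
Proof.
move=> s1 s2; apply: span_stableD => //; rewrite -mulN1r; apply: span_stableM => //.
by rewrite -(rmorphN1 phi); apply: span_stable_phi.
Qed.

Lemma span_stableVx e : span_stable (phi x * e) -> span_stable e.
Proof. by move=> sxe f /sxe sf; apply: localized_spanVx; rewrite mulrA. Qed.
End LocalizedSpan.

(** Index s = 9 j + i stands for t^i h12^j; index 0 is the element 1, whose coordinate
    [weyl_invariant_x4] reads off. *)
Definition tower_basis (s : 'I_27) : HBT := tower_mono (s %% 9) (s %/ 9).

Definition gens_eval : {rmorphism {mpoly 'F_3[13]} -> HBT} := comp_mpoly gens.

Definition in_tower : HBT -> Prop := localized_span gens_eval 'X_ord0 tower_basis.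

Lemma gens0E : gens_eval 'X_ord0 = gens`_0.
Proof. exact: comp_mpolyXU. Qed.

Lemma tower_monoD i j i' j' :
  tower_mono i j * tower_mono i' j' = tower_mono (i + i') (j + j').
Proof. by rewrite /tower_mono mulrACA -!exprD. Qed.

Lemma in_tower_mono i j : in_tower (tower_mono i j).
Proof.
have [n] := ubnP (i + 5 * j); elim: n i j => // n IH i j; rewrite ltnS => le_n.
have rule k : (k < 2)%N -> let r := tower_rule k in (r.1.1 <= i)%N -> (r.1.2 <= j)%N ->
    in_tower (tower_mono i j).
  move=> ltk r le_i le_j; apply: localized_spanVx; rewrite gens0E.
  rewrite -(subnKC le_i) -(subnKC le_j) -tower_monoD mulrA (tower_relation ltk) mulr_suml.
  have /andP[_ /allP low] := all_nthP (0, 0, [::])%N tower_rules_ok k ltk.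
  apply: localized_span_sum => x /low/andP[_ lt_x].
  rewrite -mulrA tower_monoD -eval_X_mPo -[_ \mPo gens]/(gens_eval _).
  apply: localized_spanM.
  apply: IH; apply: leq_trans le_n.
  by rewrite -/(tower_rule k) -/r in lt_x; lia.
have [lt_i|le_i] := ltnP i 9; last exact: (rule 0%N).
have [lt_j|le_j] := ltnP j 3; last exact: (rule 1%N).
have lt_s : (j * 9 + i < 27)%N by lia.
have := localized_span_b gens_eval 'X_ord0 tower_basis (Ordinal lt_s).
by rewrite /tower_basis /= modnMDl modn_small // divnMDl // divn_small // addn0.
Qed.

Lemma in_tower_mono_stable i j f : in_tower f -> in_tower (tower_mono i j * f).
Proof.
apply: localized_span_stable => s.
by rewrite /tower_basis tower_monoD; apply: in_tower_mono.
Qed.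

Lemma in_tower_d5 q : in_tower (q \mPo d5_tuple).
Proof.
pose stable := span_stable gens_eval 'X_ord0 tower_basis.
have stable_t : stable t.
  by have := @in_tower_mono_stable 1 0; rewrite /tower_mono expr1 expr0 mulr1.
have stable_h : stable h12.
  by have := @in_tower_mono_stable 0 1; rewrite /tower_mono expr1 expr0 mul1r.
have stable_gen i : (i < 13)%N -> stable gens`_i.
  move=> lti; have <- : gens_eval 'X_(inord i) = gens`_i.
    by rewrite [LHS]comp_mpolyXU (@inordK 12 i lti).
  exact: span_stable_phi.
have stable_x4 : stable x4 by have := stable_gen 0%N isT; rewrite gensE.
have stable_x8 : stable x8 by have := stable_gen 1%N isT; rewrite gensE.
have stable_y10 : stable y10 by have := stable_gen 2 isT; rewrite gensE.
have stable_x20 : stable x20 by have := stable_gen 3 isT; rewrite gensE.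
(* h16 is reached only after division by x4, through x20 = h12 x8 + h16 x4. *)
have stable_h16 : stable h16.
  apply: span_stableVx; rewrite gens0E gensE -[_`_0]/x4.
  have -> : x4 * h16 = x20 - h12 * x8 by rewrite /x20 addrC addKr mulrC.
  exact: span_stableB stable_x20 (span_stableM stable_h stable_x8).
have stable_tM k e : stable e -> stable (t ^+ k * e).
  exact: span_stableM (span_stableX k stable_t).
have stable_d5 i : stable (tnth d5_tuple i).
  have p2E : p 2 = x8 + x4 ^+ 2 by rewrite /x8 /x4 subrK.
  have c5E : c5 = y10 + t ^+ 3 * x4 + t ^+ 1 * x8 by rewrite expr1 /y10 !subrK.
  have p3E : p 3 = h12 + t ^+ 4 * x4 + t ^+ 2 * x8 - t ^+ 1 * y10.
    by rewrite expr1 /h12 !subrK addrK.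
  have p4E : p 4 = h16 + t ^+ 6 * x4 + t ^+ 4 * x8 - t ^+ 3 * y10.
    by rewrite /h16 !subrK addrK.
  have stable_tx8 k := stable_tM k _ stable_x8.
  have stable_tx4 k := stable_tM k _ stable_x4.
  have stable_ty10 k := stable_tM k _ stable_y10.
  case: i => -[|[|[|[|[|[|i]]]]]] lti; last (exfalso; discriminate lti).
1-6: rewrite (tnth_nth 0).
  - exact: stable_t.
  - exact: stable_x4.
  - rewrite -[_`_2]/(p 2) p2E.
    exact: span_stableD stable_x8 (span_stableX 2 stable_x4).
  - rewrite -[_`_3]/(p 3) p3E.
    exact: span_stableB (span_stableD (span_stableD stable_h (stable_tx4 4)) (stable_tx8 2))
      (stable_ty10 1%N).
  - rewrite -[_`_4]/(p 4) p4E.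
    exact: span_stableB (span_stableD (span_stableD stable_h16 (stable_tx4 6)) (stable_tx8 4))
      (stable_ty10 3).
  - rewrite -[_`_5]/c5 c5E.
    exact: span_stableD (span_stableD stable_y10 (stable_tx4 3)) (stable_tx8 1%N).
have tower1 : in_tower 1 by have := in_tower_mono 0 0; rewrite /tower_mono !expr0 mul1r.
rewrite comp_mpolyEX; apply: localized_span_sum => m _.
rewrite -mul_mpolyC -(comp_mpolyC _ gens) -[_ \mPo gens]/(gens_eval _).
apply: localized_spanM; rewrite comp_mpolyX -[\prod_(i < 6) _]mulr1.
suff sp : stable (\prod_(i < 6) tnth d5_tuple i ^+ m i) by apply: sp.
apply: (big_ind stable) => [|e1 e2|i _]; first exact: span_stable1.
- exact: span_stableM.
- exact: span_stableX (stable_d5 i).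
Qed.

(** * Coordinates of invariants, by means of the conjugates of t *)

Lemma mulmx_det_inj (R : idomainType) n (B : 'M[R]_n) (v : 'cV_n) :
  \det B != 0 -> B *m v = 0 -> v = 0.
Proof.
move=> B_neq0 Bv; apply/colP => i; apply: (mulfI B_neq0).
have := congr1 (mulmx (\adj B)) Bv; rewrite mulmxA mul_adj_mx mulmx0 mul_scalar_mx.
by move/colP/(_ i); rewrite !mxE mulr0.
Qed.

Lemma tower_conj : exists2 g : 'I_27 -> 6.-tuple HBT,
  forall w, weyl_fixing (g w) & forall w, t \mPo g w = lin_form w.
Proof.
apply: (fin_all_exists2 (P := fun w g => weyl_fixing g)
          (Q := fun (w : 'I_27) g => t \mPo g = lin_form w)) => w.
exact: lin_form_conj.
Qed.

(* Up to powers of x4, this matrix times an invariant one is a Vandermonde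
   matrix in the 27 distinct conjugates of t. *)
Lemma det_tower_basis (g : 'I_27 -> 6.-tuple HBT) :
    (forall w, weyl_fixing (g w)) -> (forall w, t \mPo g w = lin_form w) ->
  \det (\matrix_(w, s) (tower_basis s \mPo g w)) != 0.
Proof.
move=> g_fix gt; set B := \matrix_(w, s) _.
have [N] : exists N : 'I_27 -> nat, forall k, exists c : 'I_27 -> {mpoly 'F_3[13]},
    gens`_0 ^+ N k * t ^+ k = \sum_s (c s \mPo gens) * tower_basis s.
  apply: (fin_all_exists (P := fun (k : 'I_27) N => exists c : 'I_27 -> {mpoly 'F_3[13]},
    gens`_0 ^+ N * t ^+ k = \sum_s (c s \mPo gens) * tower_basis s)) => k.
  have := in_tower_mono k 0; rewrite /tower_mono expr0 mulr1 => -[N [c E]].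
  by exists N, c; rewrite -E gens0E.
move/fin_all_exists => [c cE].
pose V := Vandermonde 27 (\row_w lin_form (w : 'I_27)).
pose C := \matrix_(s, k) (c k s \mPo gens).
pose d : 'rV_27 := \row_k gens`_0 ^+ N k.
have BC : B *m C = V^T *m diag_mx d.
  apply/matrixP => w k; rewrite mul_mx_diag !mxE -gt -rmorphXn mulrC.
  have gens_fix q : (q \mPo gens) \mPo g w = q \mPo gens by apply/g_fix/gens_invariant.
  transitivity ((gens`_0 ^+ N k * t ^+ k) \mPo g w).
    rewrite cE [RHS]raddf_sum; apply: eq_bigr => s _; rewrite !mxE.
    by rewrite [RHS]rmorphM /= gens_fix mulrC.
  rewrite rmorphM /=; congr (_ * _).
  by rewrite -gens0E -rmorphXn; apply: gens_fix.
have : \det B * \det C != 0.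
  rewrite -det_mulmx BC det_mulmx det_tr det_diag det_Vandermonde mulf_neq0 //.
    apply/prodf_neq0 => i _; apply/prodf_neq0 => j lt_ij; rewrite !mxE.
    by apply: lin_form_inj; rewrite lt_ij ltn_ord.
  apply/prodf_neq0 => k _; rewrite mxE expf_neq0 //.
  by rewrite -(tnth_nth 0 gens ord0) gens0_neq0.
by apply: contraNneq => ->; rewrite mul0r.
Qed.

(** Write F = x4^k f as the sum of c_s b_s with c_s in A. The 27 substitutions fix F, the c_s and
    b_0 = 1, so the vector with entries c_s - delta_(s,0) F is killed by the matrix of conjugates.
    As its determinant is nonzero, F = c_0. *)
Lemma weyl_invariant_x4 f : weyl_E6_invariant f ->
  exists k q, gens`_0 ^+ k * f = q \mPo gens.
Proof.
move=> f_inv; have [q0 fq0] := weyl_invariant_d5 f_inv.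
have [k [c fE]] : in_tower f by rewrite fq0; apply: in_tower_d5.
rewrite gens0E in fE; exists k, (c ord0).
have [g g_fix gt] := tower_conj.
pose F := gens`_0 ^+ k * f.
have F_fix w : F \mPo g w = F.
  have f_g : f \mPo g w = f := g_fix w f f_inv.
  have x_g : gens`_0 \mPo g w = gens`_0.
    by rewrite -gens0E; apply/g_fix/gens_invariant.
  by rewrite /F [LHS]rmorphM rmorphXn /= f_g x_g.
pose v : 'cV[HBT]_27 := \col_s ((c s \mPo gens) - (s == ord0)%:R * F).
have /(mulmx_det_inj (det_tower_basis g_fix gt))/colP/(_ ord0) :
    \matrix_(w, s) (tower_basis s \mPo g w) *m v = 0.
  apply/colP => w; rewrite !mxE.
  transitivity (\sum_s (c s \mPo gens) * (tower_basis s \mPo g w) - F).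
    rewrite (eq_bigr (fun s => (c s \mPo gens) * (tower_basis s \mPo g w)
      - (s == ord0)%:R * F * (tower_basis s \mPo g w))); last first.
      by move=> s _; rewrite !mxE mulrC mulrBl.
    rewrite sumrB; congr (_ - _); rewrite (bigD1 ord0) // eqxx mul1r.
    rewrite big1 => [|s /negPf->]; last by rewrite !mul0r.
    have -> : tower_basis ord0 = 1.
      by rewrite /tower_basis mod0n div0n /tower_mono !expr0 mulr1.
    by rewrite [LHS]addr0 comp_mpoly1 mulr1.
  apply/eqP; rewrite subr_eq0; apply/eqP; rewrite -(F_fix w) /F fE.
  rewrite [RHS]raddf_sum; apply: eq_bigr => s _; rewrite [RHS]rmorphM /=.
  by congr (_ * _); apply/esym/g_fix/gens_invariant.
by rewrite !mxE eqxx mul1r => /eqP; rewrite subr_eq0 => /eqP.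
Qed.

(** * Cancelling powers of x4 *)

(** Independence of t, p_1, ..., p_4, c_5 lifts a relation from the weights to the formal variables
    of S, where x4 is a variable and can be set to zero. *)
Lemma d5_tuple_lift N Q x F N' Q' x' F' :
    N \mPo d5_tuple = N' -> Q \mPo d5_tuple = Q' -> x \mPo d5_tuple = x' ->
    F \mPo d5_tuple = F' ->
  N' = x' * (F' - Q') -> N = x * (F - Q).
Proof.
move=> NE QE xE FE E; apply/eqP; rewrite -subr_eq0; apply/eqP/d5_tuple_independent.
by rewrite comp_mpolyB [(_ * _) \mPo _]rmorphM /= comp_mpolyB NE QE xE FE E subrr.
Qed.

Lemma x4_saturated q f : weyl_E6_invariant f ->
  gens`_0 * f = q \mPo gens -> exists q', f = q' \mPo gens.
Proof.
move=> f_inv fE.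
have d5_exprs_size : size [seq eval d5_tuple e | e <- d5_exprs] = 7%N by [].
have [N normN [Q qE]] := reducible_all d5_exprs_size gensE q.
(* Rewriting gives x4 f = N + x4 Q in the generators, with N normal; once N vanishes, cancelling x4
   leaves f = Q. *)
exists Q; apply/eqP; rewrite -subr_eq0.
have [F FE] := weyl_invariant_d5 f_inv.
have NE : N \mPo gens = gens`_0 * (f - (Q \mPo gens)).
  rewrite mulrBr fE qE (tnth_nth 0); exact: esym (addrK _ _).
suff N0 : N = 0.
  move/esym/eqP: NE; rewrite N0 comp_mpoly0 mulf_eq0 => /orP[|//].
  by rewrite -(tnth_nth 0 gens ord0) (negPf gens0_neq0).
apply: (@normal_x4_free _ (F - (Q \mPo formal_gens)) normN).
have N_eval := comp_mpolyA N formal_gens_mPo.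
have Q_eval := comp_mpolyA Q formal_gens_mPo.
have x4_eval : tnth formal_gens ord0 \mPo d5_tuple = gens`_0.
  have sz : (0 < size formal_gens)%N by rewrite size_tuple.
  rewrite (tnth_nth 0); apply: etrans (esym (nth_map 0 0 (comp_mpoly d5_tuple) sz)) _.
  exact: esym (congr1 (fun s : seq HBT => s`_0) formal_gens_mPo).
exact: d5_tuple_lift N_eval Q_eval x4_eval (esym FE) NE.
Qed.

Theorem theorem4p13 :
  exists2 g : 13.-tuple {mpoly 'F_3[6]},
    map (@FracField.tofrac _) g = E6_generators &
    forall f : {mpoly 'F_3[6]},
      weyl_E6_invariant f <-> generated_subalgebra g f.
Proof.
exists gens; first exact: gens_tofrac.
move=> f; split=> [f_inv|[q ->]]; last exact: gens_invariant.
(* One factor x4 is removed at a time; [x4_saturated] then requires x4^k f to be invariant, which it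
   is as a product of invariants. *)
have [k [q]] := weyl_invariant_x4 f_inv; elim: k q => [|k IH] q.
  by rewrite mul1r => ->; exists q.
rewrite exprS -mulrA => /x4_saturated[|q' /IH//].
have x4_inv : weyl_E6_invariant (gens`_0 ^+ k).
  by rewrite -gens0E -rmorphXn; apply: gens_invariant.
by move=> w Ww; rewrite /lattice_act [LHS]rmorphM;
  congr (_ * _); [apply: x4_inv | apply: f_inv].
Qed.
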